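(* For any positive integers $d$ and $m$, $$\zeta^{\star}(\{\{2\}^{m-1},3,\{2\}^{m-1},1\}^d)=\pi^{4md}\sum_{\substack{k_1,\ldots,k_d\ge 0\\ k_1+3k_2+\cdots+(2d-1)k_d=2d}}\ \prod_{j=1}^d\frac{1}{k_j!}\left(\frac{(2-2^{2m(2j-1)})B_{2m(2j-1)}}{(2j-1)\cdot(2m(2j-1))!}\right)^{k_j},$$ where the sum is taken over all non-negative integers $k_1,\ldots,k_d$ satisfying $\sum_{j=1}^d(2j-1)k_j=2d$, and $$\zeta^{\star}(\{\{2\}^{m-1},3,\{2\}^{m-1},1\}^d,\{2\}^m)=\pi^{2m(2d+1)}\sum_{\substack{k_1,\ldots,k_{d+1}\ge 0\\ k_1+3k_2+\cdots+(2d+1)k_{d+1}=2d+1}}\ \prod_{j=1}^{d+1}\frac{1}{k_j!}\left(\frac{(2-2^{2m(2j-1)})B_{2m(2j-1)}}{(2j-1)\cdot(2m(2j-1))!}\right)^{k_j},$$ where the sum is over all non-negative integers $k_1,\ldots,k_{d+1}$ such that $\sum_{j=1}^{d+1}(2j-1)k_j=2d+1$.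
   Context: For positive integers $s_1,\ldots,s_r$ with $s_1>1$, the multiple zeta star value is $\zeta^\star(s_1,\ldots,s_r)=\sum_{k_1\ge\cdots\ge k_r\ge 1}\frac{1}{k_1^{s_1}\cdots k_r^{s_r}}$ (sum over positive integers). The notation $\{a_1,\ldots,a_k\}^d$ means $d$ successive repetitions of the sequence $a_1,\ldots,a_k$; in particular $\{\{2\}^{m-1},3,\{2\}^{m-1},1\}^d$ is $d$ repetitions of the sequence consisting of $m-1$ twos, a $3$, $m-1$ twos, and a $1$. The Bernoulli numbers $B_s$ are defined by $\frac{t}{e^t-1}=\sum_{s=0}^\infty B_s\frac{t^s}{s!}$.
   Formalization: The right-hand side of the second identity is multiplied by (-1)^m: as printed it is false for every odd m (for d=m=1 the printed right side is -11π^6/7560, while ζ*(3,1,2)>0); for even m it is the printed identity. *)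

(* Defs.v *)
From HB Require Import structures.
From mathcomp Require Export all_boot all_order all_algebra.
From mathcomp Require Export all_classical all_reals all_analysis.
From mathcomp Require Import ring.
Export Order.TTheory GRing.Theory Num.Theory.
Export numFieldNormedType.Exports.

Set Implicit Arguments.
Unset Strict Implicit.
Unset Printing Implicit Defensive.

Local Open Scope classical_set_scope.
Local Open Scope ring_scope.

(* The value lives in \bar R: an equation [zeta_star R s = x%:E] also asserts
   that the (unordered) sum of nonnegative terms converges. *)
Definition zeta_star (R : realType) (s : seq nat) : \bar R :=
  \esum_(k in [set k : (size s).-tuple nat |
                 sorted geq k && all (fun i => 0 < i)%N k])
    (\prod_(i < size s) ((tnth k i)%:R ^+ nth 0%N s i)^-1)%:E.

Definition repeat_seq (d : nat) (a : seq nat) : seq nat := flatten (nseq d a).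

Definition block (m : nat) : seq nat :=
  (nseq m.-1 2 ++ 3 :: nseq m.-1 2 ++ [:: 1])%N.

(* The equation t / (e^t - 1) = \sum_s B_s t^s / s!, for all small t != 0
   (at t = 0 the left-hand side is only defined by continuity). *)
Definition bernoulli_numbers (R : realType) (B : nat -> R) : Prop :=
  \forall t \near (0 : R)^',
    series (fun s => B s * t ^+ s / (s`!)%:R) @ \oo --> t / (expR t - 1).

(* Satisfiability of [bernoulli_numbers]: gf n stands for B_n / n!, obtained by
   inverting the power series (e^t - 1) / t, whose coefficients are ec. *)
Module BernoulliExists.
Section BernoulliExists.
Variable R : realType.
Let ec (j : nat) : R := ((j.+1)`!)%:R^-1.

Fixpoint gfs (n : nat) : seq R := if n is n'.+1 then
  rcons (gfs n') ((n' == 0%N)%:R - \sum_(k < n') (gfs n')`_k * ec (n' - k)) else [::].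

Definition gf n := (gfs n.+1)`_n.

Lemma size_gfs n : size (gfs n) = n.
Proof. by elim: n => //= n IH; rewrite size_rcons IH. Qed.

Lemma nth_gfs n k : (k < n)%N -> (gfs n)`_k = gf k.
Proof.
elim: n => // n IH; rewrite ltnS leq_eqVlt => /orP[/eqP-> //|kn].
by rewrite /= nth_rcons size_gfs kn IH.
Qed.

Lemma gfE n : gf n = (n == 0%N)%:R - \sum_(k < n) gf k * ec (n - k).
Proof.
rewrite /gf /= nth_rcons size_gfs ltnn eqxx; congr (_ - _).
by apply: eq_bigr => k _; rewrite nth_gfs.
Qed.

Lemma gf_conv n : \sum_(k < n.+1) gf k * ec (n - k) = (n == 0%N)%:R.
Proof. by rewrite big_ord_recr /= subnn {2}/ec invr1 mulr1 gfE addrC subrK. Qed.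

Lemma ec_ge0 j : 0 <= ec j. Proof. by rewrite /ec invr_ge0 ler0n. Qed.

Lemma ec_le j : ec j <= 2^-1 ^+ j.
Proof.
rewrite /ec exprVn lef_pV2 ?posrE ?ltr0n ?fact_gt0 ?exprn_gt0 // -natrX ler_nat.
elim: j => // j IH; rewrite factS expnS leq_mul //.
Qed.

Lemma sum_half_rev n : \sum_(k < n) (2^-1 : R) ^+ (n - k) = 1 - 2^-1 ^+ n.
Proof.
elim: n => [|n IH]; first by rewrite big_ord0 expr0 subrr.
rewrite big_ord_recr /= subSnn.
rewrite (eq_bigr (fun k : 'I_n => 2^-1 * 2^-1 ^+ (n - k))); last first.
  by move=> k _; rewrite subSn ?exprS // ltnW.
rewrite -mulr_sumr IH expr1 [2^-1 ^+ n.+1]exprS; by field.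
Qed.

Lemma sum_half_le n : \sum_(k < n) (2^-1 : R) ^+ k <= 2.
Proof.
suff -> : \sum_(k < n) (2^-1 : R) ^+ k = 2 - 2 * 2^-1 ^+ n.
  by rewrite gerBl mulr_ge0 // exprn_ge0.
elim: n => [|n IH]; first by rewrite big_ord0 expr0 mulr1 subrr.
rewrite big_ord_recr /= IH exprS; by field.
Qed.

Lemma gf_le1 n : `|gf n| <= 1.
Proof.
elim/ltn_ind: n => -[|n] IH.
  by rewrite gfE big_ord0 subr0 normr1.
rewrite gfE sub0r normrN; apply: le_trans (ler_norm_sum _ _ _) _.
apply: (@le_trans _ _ (\sum_(k < n.+1) (2^-1 : R) ^+ (n.+1 - k))).
  apply: ler_sum => k _; rewrite normrM (ger0_norm (ec_ge0 _)).
  rewrite -[leRHS]mul1r ler_pM ?ec_ge0 ?ec_le //; exact: IH.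
by rewrite sum_half_rev gerBl exprn_ge0.
Qed.

Lemma gf_truncE (t : R) N : (0 < N)%N ->
  \sum_(i < N) \sum_(j < N | (i + j < N)%N) gf i * ec j * t ^+ (i + j) = 1.
Proof.
move=> N0.
have H (i : 'I_N) : \sum_(j < N | (i + j < N)%N) gf i * ec j * t ^+ (i + j)
   = \sum_(n < N | (i <= n)%N) gf i * ec (n - i) * t ^+ n.
  rewrite -(big_mkord (fun j => i + j < N)%N (fun j => gf i * ec j * t ^+ (i + j))).
  rewrite -(big_mkord (fun n => i <= n)%N (fun n => gf i * ec (n - i) * t ^+ n)).
  have -> : \sum_(0 <= n < N | (i <= n)%N) gf i * ec (n - i) * t ^+ n
     = \sum_(i <= n < N) gf i * ec (n - i) * t ^+ n.
    by rewrite [RHS](big_nat_widenl _ 0).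
  rewrite -{4}[nat_of_ord i]add0n big_addn.
  rewrite [RHS](big_nat_widen _ _ N) ?leq_subr //.
  by apply: eq_big => n; rewrite ?ltn_subRL // addnK addnC.
rewrite (eq_bigr _ (fun i _ => H i)) (exchange_big_dep xpredT) //=.
case: N N0 {H} => // N _.
rewrite big_ord_recl /= [X in _ + X]big1 ?addr0.
  by rewrite (big_pred1 ord0) /= ?gfE ?big_ord0 ?subr0 /ec ?subn0 ?invr1 ?mulr1 // => i; rewrite leqn0.
move=> n _; transitivity ((\sum_(i < n.+2) gf i * ec (n.+1 - i)) * t ^+ n.+1).
  rewrite mulr_suml (big_ord_widen_cond N.+1 xpredT (fun i => gf i * ec (n.+1 - i) * t ^+ n.+1)) ?ltnS //.
by rewrite gf_conv mul0r.
Qed.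

Lemma gf_rem_le (t : R) N : (0 < N)%N -> `|t| <= 4^-1 ->
  `|(\sum_(i < N) gf i * t ^+ i) * (\sum_(j < N) ec j * t ^+ j) - 1|
   <= 4 * 2^-1 ^+ N.
Proof.
move=> N0 ht.
have -> : (\sum_(i < N) gf i * t ^+ i) * (\sum_(j < N) ec j * t ^+ j) =
    \sum_(i < N) \sum_(j < N) gf i * ec j * t ^+ (i + j).
  rewrite big_distrlr /=; apply: eq_bigr => i _; apply: eq_bigr => j _.
  by rewrite exprD mulrACA.
rewrite -[X in `|_ - X|](gf_truncE t N0) -sumrB.
under eq_bigr => i _ do
  rewrite (bigID (fun j : 'I_N => i + j < N)%N) /= addrC addrK.
apply: (@le_trans _ _ (\sum_(i < N) \sum_(j < N) 2^-1 ^+ N * (2^-1 ^+ i * 2^-1 ^+ j))).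
  apply: le_trans (ler_norm_sum _ _ _) _; apply: ler_sum => i _.
  apply: le_trans (ler_norm_sum _ _ _) _.
  rewrite big_mkcond; apply: ler_sum => j _; case: ifP => [|_]; last first.
    by rewrite !mulr_ge0 // exprn_ge0.
  rewrite -leqNgt => ij; rewrite !normrM normrX -exprD.
  have e1 : `|ec j| <= 1.
    by rewrite ger0_norm ?ec_ge0 //; apply: le_trans (ec_le _) _; rewrite exprn_ile1 // invf_le1 // ler1n.
  rewrite -[leRHS]mul1r ler_pM //; first by rewrite -[leRHS]mul1r ler_pM // gf_le1.
  apply: (@le_trans _ _ (4^-1 ^+ (i + j))).
    by rewrite lerXn2r ?nnegrE // invr_ge0.
  have -> : (4^-1 : R) = 2^-1 * 2^-1 by field.
  rewrite exprMn ler_wpM2r ?exprn_ge0 // ler_wiXn2l // ?invf_le1 ?ler1n ?ltr0n //.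
apply: (@le_trans _ _ ((\sum_(i < N) 2^-1 ^+ i) * (\sum_(j < N) 2^-1 ^+ j) * 2^-1 ^+ N)).
  rewrite le_eqVlt; apply/orP; left; apply/eqP.
  rewrite big_distrlr /= mulr_suml; apply: eq_bigr => i _.
  by rewrite mulr_suml; apply: eq_bigr => j _; rewrite mulrC.
rewrite ler_wpM2r ?exprn_ge0 //.
have -> : (4 : R) = 2 * 2 by ring.
by rewrite ler_pM ?sum_half_le // sumr_ge0 // => i _; rewrite exprn_ge0.
Qed.

Lemma bernoulli_numbers_exists : exists B : nat -> R, bernoulli_numbers B.
Proof.
exists (fun n => (n`!)%:R * gf n).
rewrite /bernoulli_numbers.
have : \forall t \near (0:R)^', `|t| <= 4^-1.
  apply: nbhs_dnbhs; exists 4^-1 => /=; first by rewrite invr_gt0.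
  by move=> t /=; rewrite sub0r normrN => /ltW.
have : \forall t \near (0:R)^', t != 0 by exact: nbhs_dnbhs_neq.
apply: filterS2 => t t0 ht.
set P := series _.
pose E N := \sum_(j < N) ec j * t ^+ j.
have PE N : P N = \sum_(i < N) gf i * t ^+ i.
  rewrite /P /series /= big_mkord; apply: eq_bigr => i _.
  by field; rewrite pnatr_eq0 -lt0n fact_gt0.
have EE N : E N = (series (exp_coeff t) N.+1 - 1) / t.
  rewrite /series /= big_mkord big_ord_recl /exp_coeff /= expr0 fact0 divr1.
  rewrite addrC addKr mulr_suml; apply: eq_bigr => i _.
  rewrite /ec /bump /= add1n exprS; field.
  by rewrite t0 /= pnatr_eq0 -lt0n fact_gt0.
have cE : E @ \oo --> (expR t - 1) / t.
  rewrite (_ : E = fun N => (series (exp_coeff t) N.+1 - 1) / t); last exact/funext.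
  apply: cvgMr_tmp; apply: cvgB; last exact: cvg_cst.
  have : series (exp_coeff t) @ \oo --> expR t by exact: is_cvg_series_exp_coeff.
  by rewrite -cvg_shiftS.
have cPE : (fun N => P N * E N) @ \oo --> (1 : R).
  apply/subr_cvg0/norm_cvg0P.
  apply: (@squeeze_cvgr _ _ _ _ (cst 0) (fun N => 4 * 2^-1 ^+ N)).
  - near=> N; rewrite normr_ge0 /= PE; apply: gf_rem_le => //; near: N; exact: nbhs_infty_gt.
  - exact: cvg_cst.
  - rewrite -[X in _ --> X](mulr0 4); apply: cvgMl_tmp.
    by apply: cvg_expr; rewrite ger0_norm // invf_lt1 // ltr1n.
have G0 : (expR t - 1) / t != 0.
  by rewrite mulf_neq0 ?invr_eq0 // subr_eq0 -expR0 (inj_eq (@expR_inj _)).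
have -> : t / (expR t - 1) = 1 * ((expR t - 1) / t)^-1 by rewrite mul1r invf_div.
have cQ := cvgM cPE (cvgV G0 cE).
have PQ : \forall N \near \oo, P N = (P N * E N) * (E N)^-1.
  have En : \forall N \near \oo, E N != 0 by apply: (cvgr_neq0 _ cE G0).
  by apply: filterS En => N EN; rewrite mulfK.
apply: cvg_trans (cQ _ _); apply: near_eq_cvg.
by apply: filterS PQ => N h; first [exact: h | exact: (esym h)].
Unshelve. all: by end_near.
Qed.

End BernoulliExists.
End BernoulliExists.

Definition bernoulli_coef (R : realType) (B : nat -> R) (m p : nat) : R :=
  (2 - 2 ^+ (2 * m * p)) * B (2 * m * p)%N / (p%:R * ((2 * m * p)`!)%:R).

(* Indices are shifted by one: j : 'I_d stands for j + 1, so that the odd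
   number 2(j + 1) - 1 is j.*2.+1.  Ranging over k_j <= n loses nothing, since
   the constraint forces it. *)
Definition bernoulli_sum (R : realType) (B : nat -> R) (m d n : nat) : R :=
  \sum_(k : {ffun 'I_d -> 'I_n.+1} | (\sum_(j < d) j.*2.+1 * k j == n)%N)
    \prod_(j < d) (((k j)`!)%:R^-1 * bernoulli_coef B m j.*2.+1 ^+ k j).

(* Sign: for p odd, bernoulli_coef B m p has the sign of (-1) ^+ m, and for n
   odd every product in bernoulli_sum has an odd number of factors.  Hence
   bernoulli_sum B m d n has the sign of (-1) ^+ m when n is odd, and equals
   a positive zeta star value only after multiplication by (-1) ^+ m; e.g.
   B_2 = 1/6 and B_6 = 1/42 give bernoulli_sum B 1 2 3 = - 11/7560 (not
   positive), while zeta_star R [:: 3; 1; 2] > 0. *)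

(* Main.v *)
Require Import Defs.
From mathcomp Require Import ring lra.
Local Open Scope ring_scope.

Set Implicit Arguments.
Unset Strict Implicit.
Unset Printing Implicit Defensive.

(** The finite star sums S_N(s), where the outermost index runs up to N, can be
    written as single sums \sum_(1 <= k <= N) w_N(k) f(k), where the weight
    w_N(k) = C(2N, N - k) / C(2N, N) no longer involves the composition s.  The
    empty composition is represented by f(k) = 2 (-1)^(k-1), and prepending an
    entry 1, 2 or 3 to s acts on f by an explicit operator.  The reason is that
    T(j) = (N + j) w_N(j) satisfies T(j + 1) = (N - j) w_N(j), so that every
    identity needed is a telescoping sum ([abel_weight], [abel_weight_alt]).
    Prepending the whole block {2}^(m-1), 3, {2}^(m-1), 1 amounts to applying
    twice the operator

      (L f)(j) = a_j (f(j) + 2 \sum_(k < j) f(k)),    a_j = (-1)^(j-1) / j^(2m),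

    and {2}^m is represented by L f_0, with f_0 the function of the empty
    composition.  Hence both families of the theorem are the L^n f_0, for n even
    and for n odd ([represents_repeat], [represents_repeat_twos]).

    As N tends to infinity the weights tend to 1; as L^n f_0 is O(1/k^2) for n > 0,
    the star value is \sum_k (L^n f_0)(k) ([weighted_sum_cvg], [star_sum_cvg]).
    Up to N, these sums are the coefficients of \prod_(k <= N) (1 + a_k x) /
    (1 - a_k x), which is the exponential of \sum_(p odd) x^p / p *
    2 \sum_(k <= N) a_k^p.  Expanding the exponential gives the sum over
    (k_1, ..., k_d) of the theorem ([odd_power_sum_expansion]), with
    2 \sum_k a_k^p in place of the Bernoulli numbers.

    It remains to evaluate 2 \sum_k (-1)^(k-1) / k^(2n).  The representation of
    {2}^n shows that it is the limit of S_N({2}^n), the complete homogeneous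
    symmetric function of 1, 1/4, ..., 1/N^2.  The normalized moments of t^(2j)
    against cos^(2N) on [0, pi/2] satisfy a recurrence in N which links their
    values at N = 0, which are the Taylor coefficients of sinh(pi x) / (pi x), to
    S_N({2}^n); for j > 0 they tend to 0 with 1/N ([scaled_moment_star_sum],
    [scaled_moment_cvg0]).  In the limit, the numbers (-1)^n S_oo({2}^n) are
    therefore the coefficients of the power series inverse to
    sinh(pi x) / (pi x), which is pi x / sinh(pi x), and t / sinh t =
    2t/(e^t - 1) - 2t/(e^(2t) - 1) has coefficients (2 - 2^s) B_s / s!
    ([csch_coef_rec], [star_sum_twos_cvg]). *)

(** * Finite star sums and the central binomial weights *)

Section FiniteSums.
Variable R : realType.
Implicit Types (f g : nat -> R) (s : seq nat).

(** The outermost index comes first in the composition, so the recursion peels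
    off the largest summation variable. *)
Fixpoint star_sum s (N : nat) : R :=
  if s is a :: s' then \sum_(1 <= j < N.+1) (j%:R ^+ a)^-1 * star_sum s' j else 1.

(** This is C(2N, N - k) / C(2N, N), in a form that vanishes for k > N without a
    side condition. *)
Definition weight (N k : nat) : R := \prod_(i < k) ((N%:R - i%:R) / (N + i.+1)%:R).

Definition alt_sign (k : nat) : R := (-1) ^+ k.-1.

Lemma weight0 N : weight N 0 = 1.
Proof. by rewrite /weight big_ord0. Qed.

Lemma weightS N k : (N + k.+1)%:R * weight N k.+1 = (N%:R - k%:R) * weight N k.
Proof.
have n0 : (N + k.+1)%:R != 0 :> R by rewrite pnatr_eq0 addnS.
by rewrite /weight big_ord_recr /=; field.
Qed.

Lemma weight_gt N k : (N < k)%N -> weight N k = 0.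
Proof.
move=> Nk; rewrite /weight (bigD1 (Ordinal Nk)) //=.
by rewrite subrr mul0r mul0r.
Qed.

Lemma weight_step N k :
  weight N.+1 k * (N.+1%:R ^+ 2 - k%:R ^+ 2) = weight N k * N.+1%:R ^+ 2.
Proof.
elim: k => [|k IH]; first by rewrite !weight0 expr0n subr0.
have n1 : (N + k.+1)%:R != 0 :> R by rewrite pnatr_eq0 addnS.
apply: (mulfI n1); rewrite [RHS]mulrA weightS -mulrA -IH.
have := weightS N.+1 k; rewrite addSnnS => e.
have -> : (N + k.+1)%:R * (weight N.+1 k.+1 * (N.+1%:R ^+ 2 - k.+1%:R ^+ 2)) =
  (N%:R - k%:R) * (N + k.+1)%:R * ((N + k.+2)%:R * weight N.+1 k.+1).
  by rewrite !natrD -!natr1; ring.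
by rewrite e natrD -!natr1; ring.
Qed.

Lemma weight_increment N k :
  weight N.+1 k - weight N k = weight N.+1 k * k%:R ^+ 2 / N.+1%:R ^+ 2.
Proof.
have n0 : N.+1%:R ^+ 2 != 0 :> R by rewrite expf_neq0 // pnatr_eq0.
apply: (mulIf n0); rewrite mulrBl -weight_step divfK //; ring.
Qed.

Lemma alt_signS k : (0 < k)%N -> alt_sign k.+1 = - alt_sign k.
Proof. by case: k => // k _; rewrite /alt_sign /= exprS mulN1r. Qed.

Lemma alt_sign_sqr k : alt_sign k * alt_sign k = 1.
Proof. by rewrite -expr2 sqrr_sign. Qed.

Lemma sum_alt_sign j : \sum_(1 <= k < j.+1) alt_sign k = (odd j)%:R.
Proof.
elim: j => [|j IH]; first by rewrite big_geq.
by rewrite big_nat_recr //= IH /alt_sign /= -signr_odd; case: odd => /=; ring.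
Qed.

Definition represents f s := forall N, (0 < N)%N ->
  star_sum s N = \sum_(1 <= k < N.+1) weight N k * f k.

Lemma represents_ext f g s : (forall k, (0 < k)%N -> f k = g k) ->
  represents f s -> represents g s.
Proof.
move=> fg rf N N0; rewrite rf //.
by apply: eq_big_nat => k /andP[k0 _]; rewrite fg.
Qed.

(** The increment of w_N(k) in N is w_N(k) k^2 / N^2, so the sum over the new
    outermost index reduces to an identity at a single N. *)
Lemma represents_cons f g s a : represents f s ->
  (forall N, (0 < N)%N ->
    (N%:R ^+ a)^-1 * \sum_(1 <= k < N.+1) weight N k * f k =
    (N%:R ^+ 2)^-1 * \sum_(1 <= k < N.+1) weight N k * (k%:R ^+ 2 * g k)) ->
  represents g (a :: s).
Proof.
move=> rf fg N _ /=; elim: N => [|N IH]; first by rewrite !big_geq.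
rewrite big_nat_recr //= IH rf // fg // mulr_sumr.
have -> : \sum_(1 <= k < N.+1) weight N k * g k = \sum_(1 <= k < N.+2) weight N k * g k.
  by rewrite [RHS]big_nat_recr //= weight_gt // mul0r addr0.
rewrite -big_split /=; apply: eq_bigr => k _.
have -> : weight N.+1 k * g k = weight N k * g k + (weight N.+1 k - weight N k) * g k.
  by ring.
by rewrite weight_increment; congr (_ + _); ring.
Qed.

(** With T(j) = (N + j) w_N(j), summation by parts: the difference of both sides
    is the telescoping sum of T(j) \sum_(k < j) f(k), which vanishes at both ends
    since w_N(N + 1) = 0. *)
Lemma abel_weight f N : \sum_(1 <= j < N.+1) weight N j *
    (j%:R * (f j + 2 * \sum_(1 <= k < j) f k)) =
  N%:R * \sum_(1 <= j < N.+1) weight N j * f j.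
Proof.
apply/eqP; rewrite -subr_eq0 mulr_sumr -sumrB.
pose T j := - ((N + j)%:R * weight N j * \sum_(1 <= k < j) f k).
rewrite (eq_big_nat _ _ (F2 := fun j => T j.+1 - T j)); last first.
  move=> j /andP[j0 _]; rewrite /T weightS big_nat_recr //= natrD; ring.
rewrite telescope_sumr // /T weight_gt // [in X in _ - X]big_geq //.
by rewrite !(mulr0, mul0r, oppr0, subr0).
Qed.

(** The alternating analogue: signs turn the difference of consecutive T(j) into
    a sum, which exchanges the roles of j and N. *)
Lemma abel_weight_alt f N : N%:R * \sum_(1 <= j < N.+1) weight N j *
    (f j + 2 * alt_sign j * \sum_(1 <= k < j) alt_sign k * f k) =
  \sum_(1 <= j < N.+1) weight N j * (j%:R * f j).
Proof.
apply/eqP; rewrite -subr_eq0 mulr_sumr -sumrB.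
pose T j :=
  - (alt_sign j * ((N + j)%:R * weight N j * \sum_(1 <= k < j) alt_sign k * f k)).
rewrite (eq_big_nat _ _ (F2 := fun j => T j.+1 - T j)); last first.
  move=> j /andP[j0 _]; rewrite /T weightS big_nat_recr //= natrD alt_signS //.
  rewrite -[LHS]addr0 -(mulr0 ((N%:R - j%:R) * weight N j * f j)).
  by rewrite -(subrr 1) -[in X in _ * (X - _)](alt_sign_sqr j); ring.
rewrite telescope_sumr // /T weight_gt // [in X in _ - X]big_geq //.
by rewrite !(mulr0, mul0r, oppr0, subr0).
Qed.

(** The case k = 0 of the telescoping behind [abel_weight_alt]: the alternating sum
    of the weights over -N <= k <= N vanishes. *)
Lemma represents_nil : represents (fun k => 2 * alt_sign k) [::].
Proof.
move=> N N0 /=; have n0 : N%:R != 0 :> R by rewrite pnatr_eq0 -lt0n.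
apply: (mulfI n0); rewrite mulr1 mulr_sumr.
pose T j := - (alt_sign j * ((N + j)%:R * weight N j)).
rewrite (eq_big_nat _ _ (F2 := fun j => T j.+1 - T j)); last first.
  move=> j /andP[j0 _]; rewrite /T weightS natrD alt_signS //; ring.
rewrite telescope_sumr // /T weight_gt // weightS weight0 /alt_sign /=.
by rewrite subr0; ring.
Qed.

Lemma represents_cons1 f s : represents f s ->
  represents (fun j => (f j + 2 * \sum_(1 <= k < j) f k) / j%:R) (1%N :: s).
Proof.
move=> rf; apply: (represents_cons rf) => N N0.
have n0 : N%:R != 0 :> R by rewrite pnatr_eq0 -lt0n.
have -> : \sum_(1 <= j < N.+1) weight N j * f j = N%:R^-1 *
    \sum_(1 <= j < N.+1) weight N j * (j%:R * (f j + 2 * \sum_(1 <= k < j) f k)).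
  by rewrite abel_weight mulKf.
rewrite mulrA expr1 -invfM; congr (_ * _).
apply: eq_big_nat => j /andP[j0 _]; congr (_ * _).
have j0' : j%:R != 0 :> R by rewrite pnatr_eq0 -lt0n.
by field.
Qed.

Lemma represents_cons2 f s : represents f s ->
  represents (fun j => f j / j%:R ^+ 2) (2%N :: s).
Proof.
move=> rf; apply: (represents_cons rf) => N N0; congr (_ * _).
apply: eq_big_nat => j /andP[j0 _].
have j0' : j%:R != 0 :> R by rewrite pnatr_eq0 -lt0n.
by field.
Qed.

Lemma represents_cons3 f s : represents f s ->
  represents (fun j => (f j / j%:R + 2 * alt_sign j *
    \sum_(1 <= k < j) alt_sign k * (f k / k%:R)) / j%:R ^+ 2) (3%N :: s).
Proof.
move=> rf; apply: (represents_cons rf) => N N0.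
have n0 : N%:R != 0 :> R by rewrite pnatr_eq0 -lt0n.
have -> : \sum_(1 <= j < N.+1) weight N j * f j =
    \sum_(1 <= j < N.+1) weight N j * (j%:R * (f j / j%:R)).
  apply: eq_big_nat => j /andP[j0 _].
  have j0' : j%:R != 0 :> R by rewrite pnatr_eq0 -lt0n.
  by field.
rewrite -(abel_weight_alt (fun j => f j / j%:R)).
set S := \sum_(_ <= _ < _) _; set S' := \sum_(_ <= _ < _) _.
suff -> : S' = S by field.
apply: eq_big_nat => j /andP[j0 _].
have j0' : j%:R != 0 :> R by rewrite pnatr_eq0 -lt0n.
by rewrite [X in _ * X = _]mulrC divfK // expf_neq0.
Qed.

Lemma represents_nseq2 f s p : represents f s ->
  represents (fun j => f j / j%:R ^+ (2 * p)) (nseq p 2%N ++ s).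
Proof.
move=> rf; elim: p => [|p IH].
  by apply: represents_ext rf => k _; rewrite divr1.
apply: represents_ext (represents_cons2 IH) => k k0.
by rewrite -mulrA -invfM -exprD mulnS addnC.
Qed.

Definition alt_inv_pow (m k : nat) : R := alt_sign k / k%:R ^+ (2 * m).

(** Half of the effect of a block: the entry 1 and the entry 3 each contribute one
    application. *)
Definition ladder (a f : nat -> R) (j : nat) := a j * (f j + 2 * \sum_(1 <= k < j) f k).

(** The entry 1 contributes the sum over smaller indices without signs, the entry 3
    the one with signs; moving the sign of the inner index into the inner function
    makes both of the same form. *)
Lemma represents_block m f s : (0 < m)%N -> represents f s ->
  represents (ladder (alt_inv_pow m) (ladder (alt_inv_pow m) f)) (block m ++ s).
Proof.
case: m => // m _ rf; rewrite /block /= -catA /= -catA /=.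
have r1 := represents_nseq2 m (represents_cons1 rf).
have := represents_nseq2 m (represents_cons3 r1).
apply: represents_ext => j j0; rewrite {1}/ladder /alt_inv_pow.
have N0 (k : nat) : (0 < k)%N -> (k%:R != 0 :> R) * (k%:R ^+ (2 * m) != 0 :> R).
  by move=> k0; split; rewrite ?expf_neq0 // pnatr_eq0 -lt0n.
have e k : (0 < k)%N -> k%:R ^+ (2 * m.+1) = k%:R ^+ 2 * k%:R ^+ (2 * m) :> R.
  by move=> k0; rewrite -exprD; congr (_ ^+ _); ring.
set S := \sum_(1 <= k < j) alt_sign k * _; set S' := \sum_(1 <= k < j) ladder _ _ k.
have -> : S = S'.
  apply: eq_big_nat => k /andP[k0 _]; rewrite /ladder e //.
  by field; rewrite !N0.
rewrite /ladder e //; set S2 := \sum_(1 <= k < j) _.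
have := alt_sign_sqr j; set x := alt_sign j => xx.
have -> : x / (j%:R ^+ 2 * j%:R ^+ (2 * m)) *
   (x / (j%:R ^+ 2 * j%:R ^+ (2 * m)) * (f j + 2 * S2) + 2 * S') =
  (x * x * (f j + 2 * S2)  / (j%:R ^+ 2 * j%:R ^+ (2 * m)) + 2 * x * S') /
    (j%:R ^+ 2 * j%:R ^+ (2 * m)).
  by field; rewrite !N0.
by rewrite xx; field; rewrite !N0.
Qed.

Definition ladder_iter (m n : nat) : nat -> R :=
  iter n (ladder (alt_inv_pow m)) (fun k => 2 * alt_sign k).

Lemma represents_repeat_block m d s n : (0 < m)%N -> represents (ladder_iter m n) s ->
  represents (ladder_iter m (2 * d + n)) (repeat_seq d (block m) ++ s).
Proof.
move=> m0 rs; elim: d => [|d IH] //.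
rewrite -[repeat_seq d.+1 _]/(block m ++ repeat_seq d (block m)) -catA mulnS -addnA.
exact: (represents_block m0 IH).
Qed.

(** The alternating sums of signs are 0 or 1, which is why the empty composition fits
    as the zeroth term of the sequence. *)
Lemma ladder_iter1 m k : (0 < k)%N -> ladder_iter m 1 k = 2 * alt_inv_pow m k.
Proof.
case: k => // k _; rewrite /ladder_iter /= /ladder -mulr_sumr sum_alt_sign /alt_sign /=.
by rewrite -signr_odd; case: odd => /=; ring.
Qed.

Lemma represents_repeat m d : (0 < m)%N ->
  represents (ladder_iter m (2 * d)) (repeat_seq d (block m)).
Proof.
move=> m0; have := represents_repeat_block d m0 (n := 0) represents_nil.
by rewrite addn0 cats0.
Qed.

Lemma represents_twos p : represents (fun k => 2 * alt_inv_pow p k) (nseq p 2%N).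
Proof.
have := represents_nseq2 p represents_nil; rewrite cats0.
by apply: represents_ext => k _; rewrite mulrA.
Qed.

Lemma represents_repeat_twos m d : (0 < m)%N ->
  represents (ladder_iter m (2 * d).+1) (repeat_seq d (block m) ++ nseq m 2%N).
Proof.
move=> m0; rewrite -addn1; apply: represents_repeat_block => //.
by apply: represents_ext (represents_twos m) => k k0; rewrite ladder_iter1.
Qed.

(** The value at n = 0 is set to 1, not to a sum, so that these are the
    coefficients of a power series with constant term 1. *)
Definition ladder_sum (m n N : nat) : R :=
  if n is 0 then 1 else \sum_(1 <= k < N.+1) ladder_iter m n k.

Lemma ladder_iterE m n k : (0 < k)%N -> 
  ladder_iter m n.+1 k = alt_inv_pow m k * (ladder_sum m n k + ladder_sum m n k.-1).
Proof.
case: n => [|n] k0; first by rewrite ladder_iter1 // mulrC.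
rewrite [LHS]/= {1}/ladder -/(ladder_iter m n.+1) /ladder_sum.
case: k k0 => // k _; rewrite [X in _ = _ * (X + _)]big_nat_recr //=.
by rewrite -/(ladder_iter m n.+1); ring.
Qed.

(** Coefficientwise form of (1 - a_N x) P_N = (1 + a_N x) P_(N-1) for the
    generating series P_N = \sum_n (ladder_sum n N) x^n. *)
Lemma ladder_sumS m n N : ladder_sum m n.+1 N.+1 = ladder_sum m n.+1 N +
  alt_inv_pow m N.+1 * (ladder_sum m n N.+1 + ladder_sum m n N).
Proof. by rewrite -ladder_iterE // /ladder_sum big_nat_recr. Qed.

End FiniteSums.

(** * Logarithmic derivatives of truncated power series *)

Section LogDerivative.
Variable R : numFieldType.
Implicit Types (P Q U V : {poly R}) (a c : R).

Lemma dvdXnP M P : reflect (forall i, (i < M)%N -> P`_i = 0) ('X^M %| P).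
Proof.
apply: (iffP (dvdpP _ _)) => [[Q ->] i iM|P0]; first by rewrite coefMXn iM.
exists (drop_poly M P); rewrite -[LHS](poly_take_drop M).
suff -> : take_poly M P = 0 by rewrite add0r.
by apply/polyP => i; rewrite coef_take_poly coef0; case: ifP => // /P0.
Qed.

(** P' / P = U as power series modulo X^M, stated without division. *)
Definition has_log_deriv M P U := 'X^M %| P^`() - P * U.

Lemma has_log_deriv1 M : has_log_deriv M 1 0.
Proof. by rewrite /has_log_deriv -polyC1 derivC mulr0 subrr dvdp0. Qed.

Lemma has_log_derivM M P Q U V : has_log_deriv M P U -> has_log_deriv M Q V ->
  has_log_deriv M (P * Q) (U + V).
Proof.
rewrite /has_log_deriv => hP hQ; rewrite derivM.
have -> : P^`() * Q + P * Q^`() - P * Q * (U + V) =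
  (P^`() - P * U) * Q + P * (Q^`() - Q * V) by ring.
by rewrite dvdp_addr ?(dvdp_mulr _ hP) // dvdp_mull.
Qed.

Lemma has_log_deriv_prod M (I : Type) (r : seq I) (P U : I -> {poly R}) :
  (forall i, has_log_deriv M (P i) (U i)) ->
  has_log_deriv M (\prod_(i <- r) P i) (\sum_(i <- r) U i).
Proof.
move=> h; elim/big_rec2: _ => [|i p q _ hp]; first exact: has_log_deriv1.
exact: has_log_derivM.
Qed.

(** In characteristic zero, P' = P U determines the coefficients of P one after the
    other from the constant term. *)
Lemma has_log_deriv_unique M P Q U V : has_log_deriv M P U -> has_log_deriv M Q V ->
  (forall i, (i < M)%N -> U`_i = V`_i) -> P`_0 = Q`_0 ->
  forall i, (i <= M)%N -> P`_i = Q`_i.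
Proof.
move=> /dvdXnP hP /dvdXnP hQ UV PQ0; elim/ltn_ind => -[|i] IH // iM.
have := hP i iM; have := hQ i iM; rewrite !coefB !coef_deriv !coefM.
move=> /subr0_eq eQ /subr0_eq eP.
apply: (@mulIf _ i.+1%:R); first by rewrite pnatr_eq0.
rewrite !mulr_natr eP eQ; apply: eq_bigr => j _.
rewrite IH ?UV // ?(leq_ltn_trans (leq_subr _ _)) // ?ltn_ord // ltnW //.
by rewrite (leq_ltn_trans _ iM) // -ltnS.
Qed.

Definition geom_poly M a : {poly R} := \sum_(i < M.+1) (a *: 'X) ^+ i.

Lemma geom_polyE M a : (1 - a *: 'X) * geom_poly M a = 1 - (a *: 'X) ^+ M.+1.
Proof.
rewrite -[in RHS](expr1n _ M.+1) subrXX; congr (_ * _).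
by apply: eq_bigr => i _; rewrite expr1n mul1r.
Qed.

Lemma dvdXn_scaleX M k a : (M <= k)%N -> 'X^M %| (a *: 'X : {poly R}) ^+ k.
Proof. by move=> Mk; rewrite exprZn -mul_polyC dvdp_mull // dvdp_exp2l. Qed.

Lemma coef_geom M a i : (geom_poly M a)`_i = if (i <= M)%N then a ^+ i else 0.
Proof.
rewrite /geom_poly (eq_bigr (fun j : 'I_M.+1 => a ^+ j *: 'X^j)); last first.
  by move=> j _; rewrite exprZn.
by rewrite -(poly_def _ (fun j => a ^+ j)) coef_poly ltnS.
Qed.


Lemma has_log_deriv_geom M a : has_log_deriv M (geom_poly M a) (a *: geom_poly M a).
Proof.
apply/dvdXnP => i iM; rewrite coefB coef_deriv coef_geom iM -scalerAr coefZ coefM.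
rewrite (eq_bigr (fun=> a ^+ i)); last first.
  move=> [j /=]; rewrite ltnS => ji _; rewrite !coef_geom (leq_trans ji (ltnW iM)).
  by rewrite (leq_trans (leq_subr _ _) (ltnW iM)) -exprD subnKC.
by rewrite sumr_const card_ord exprS mulrnAr subrr.
Qed.

Lemma has_log_deriv_lin M a :
  has_log_deriv M (1 + a *: 'X) (a *: geom_poly M (- a)).
Proof.
rewrite /has_log_deriv derivD -polyC1 derivC add0r derivZ derivX polyC1.
have := geom_polyE M (- a); rewrite scaleNr opprK => e.
rewrite -scalerAr e -scalerBr opprD opprK addNKr.
rewrite -mul_polyC dvdp_mull // -scaleNr dvdXn_scaleX //.
Qed.

(** A polynomial agreeing with (1 + aX) / (1 - aX) up to degree M. *)
Definition cayley_poly M a : {poly R} := (1 + a *: 'X) * geom_poly M a.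

Lemma coef_cayley0 M a : (cayley_poly M a)`_0 = 1.
Proof.
by rewrite /cayley_poly mulrDl mul1r coefD coef_geom -scalerAl coefZ coefXM mulr0 addr0.
Qed.

Lemma coef_prod_cayley0 M (a : nat -> R) N :
  (\prod_(1 <= k < N.+1) cayley_poly M (a k))`_0 = 1.
Proof.
elim: N => [|N IH]; first by rewrite big_geq // coef1.
by rewrite big_nat_recr //= coef0M IH coef_cayley0 mulr1.
Qed.

Lemma coef_prod_cayley M (a : nat -> R) (e : nat -> nat -> R) :
  (forall N, e 0%N N = 1) -> (forall n, e n.+1 0%N = 0) ->
  (forall n N, e n.+1 N.+1 = e n.+1 N + a N.+1 * (e n N.+1 + e n N)) ->
  forall N n, (n <= M)%N -> e n N = (\prod_(1 <= k < N.+1) cayley_poly M (a k))`_n.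
Proof.
move=> e0 eS0 eSS; elim=> [|N IHN].
  by case=> [|n] _; rewrite ?e0 ?eS0 big_geq // coef1.
elim=> [|n IHn] nM; first by rewrite e0 coef_prod_cayley0.
rewrite eSS IHN // IHn ?(ltnW nM) // IHN ?(ltnW nM) //.
set P := \prod_(1 <= k < N.+1) _; set b := a N.+1.
have -> : \prod_(1 <= k < N.+2) cayley_poly M (a k) = P * cayley_poly M b.
  by rewrite big_nat_recr.
have eP : (1 - b *: 'X) * (P * cayley_poly M b) =
    (1 + b *: 'X) * P - (1 + b *: 'X) * P * (b *: 'X) ^+ M.+1.
  have -> : (1 - b *: 'X) * (P * cayley_poly M b) =
      (1 + b *: 'X) * P * ((1 - b *: 'X) * geom_poly M b) by rewrite /cayley_poly; ring.
  by rewrite geom_polyE; ring.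
have /dvdXnP z : 'X^(M.+1) %| (1 + b *: 'X) * P * (b *: 'X) ^+ M.+1.
  by rewrite dvdp_mull // dvdXn_scaleX.
have := congr1 (fun p : {poly R} => p`_n.+1) eP.
rewrite coefB z ?ltnS // subr0 mulrBl mul1r coefB -scalerAl coefZ coefXM /=.
rewrite mulrDl mul1r coefD -scalerAl coefZ coefXM /=.
by move=> /eqP; rewrite subr_eq => /eqP ->; ring.
Qed.

Definition cayley_log_deriv M a : {poly R} := a *: geom_poly M (- a) + a *: geom_poly M a.

Lemma has_log_deriv_cayley M a : has_log_deriv M (cayley_poly M a) (cayley_log_deriv M a).
Proof. exact: has_log_derivM (has_log_deriv_lin _ _) (has_log_deriv_geom _ _). Qed.

Lemma coef_cayley_log_deriv M a i : (i <= M)%N ->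
  (cayley_log_deriv M a)`_i = if odd i then 0 else 2 * a ^+ i.+1.
Proof.
move=> iM; rewrite coefD !coefZ !coef_geom iM exprNn -signr_odd exprS.
by case: odd => /=; ring.
Qed.

(** The truncated exponential series evaluated at P. *)
Definition exp_poly n P : {poly R} := \sum_(i < n.+1) (i`!%:R)^-1 *: P ^+ i.

(** Differentiating shifts the exponential series, so the error is the last term,
    a multiple of P^n, hence of X^n. *)
Lemma has_log_deriv_exp n P : 'X %| P -> has_log_deriv n (exp_poly n P) P^`().
Proof.
move=> XP; rewrite /has_log_deriv /exp_poly [X in X^`()]big_ord_recl.
rewrite expr0 derivD derivZ -polyC1 derivC scaler0 add0r raddf_sum /=.
rewrite [X in _ - X * _]big_ord_recr mulrDl /= mulr_suml.
rewrite (eq_bigr (fun i : 'I_n => ((i`!%:R)^-1 *: P ^+ i) * P^`())); last first.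
  move=> i _; rewrite derivZ deriv_exp /bump /= add1n -[X in _ *: X]scaler_nat scalerA.
  have -> : (i.+1`!)%:R^-1 * i.+1%:R = (i`!)%:R^-1 :> R.
    by rewrite factS natrM invfM mulrAC mulVf ?mul1r // pnatr_eq0.
  by rewrite -scalerAl // mulrC.
rewrite opprD addrA subrr add0r -mulNr -scaleNr dvdp_mulr // -mul_polyC dvdp_mull //.
by rewrite dvdp_exp2r.
Qed.

Lemma coef_exp_poly0 n P : 'X %| P -> (exp_poly n P)`_0 = 1.
Proof.
move=> XP; rewrite /exp_poly big_ord_recl expr0 coefD coefZ coef1 fact0 invr1 mulr1.
rewrite coef_sum big1 ?addr0 // => i _; rewrite coefZ exprS /bump /= coef0M.
by move/(dvdXnP 1): XP => ->; rewrite ?mul0r ?mulr0.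
Qed.

Lemma coef_prod_exp_monomial (d n : nat) (c : 'I_d -> R) (p : 'I_d -> nat) :
  (\prod_(j < d) exp_poly n (c j *: 'X^(p j)))`_n =
  \sum_(k : {ffun 'I_d -> 'I_n.+1} | (\sum_(j < d) p j * k j == n)%N)
    \prod_(j < d) (((k j)`!)%:R^-1 * c j ^+ k j).
Proof.
rewrite /exp_poly bigA_distr_bigA /= coef_sum [RHS]big_mkcond.
apply: eq_bigr => k _.
rewrite (eq_bigr (fun j => (((k j)`!)%:R^-1 * c j ^+ k j) *: 'X^(p j * k j))); last first.
  by move=> j _; rewrite exprZn scalerA -exprM.
rewrite scaler_prod -expr_sum coefZ coefXn eq_sym.
by case: ifP => _; rewrite ?mulr1 ?mulr0.
Qed.

(** The recurrence on e says that its generating series is the product of the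
    (1 + a_k x) / (1 - a_k x), whose logarithm is 2 \sum_(p odd) p_k x^p / p in
    terms of the power sums of a.  Both this product and the product of the
    exponentials of the terms of the logarithm have the same logarithmic
    derivative, hence the same coefficients.  The bound on n ensures that the odd
    numbers up to n are among 1, 3, ..., 2d - 1. *)
Lemma odd_power_sum_expansion (a : nat -> R) (e : nat -> nat -> R) d n N :
  (forall N, e 0%N N = 1) -> (forall n, e n.+1 0%N = 0) ->
  (forall n N, e n.+1 N.+1 = e n.+1 N + a N.+1 * (e n N.+1 + e n N)) ->
  (n <= 2 * d)%N ->
  e n N = \sum_(k : {ffun 'I_d -> 'I_n.+1} | (\sum_(j < d) j.*2.+1 * k j == n)%N)
    \prod_(j < d) (((k j)`!)%:R^-1 *
      ((2 * \sum_(1 <= i < N.+1) a i ^+ j.*2.+1) / j.*2.+1%:R) ^+ k j).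
Proof.
move=> e0 eS0 eSS nd; rewrite (coef_prod_cayley e0 eS0 eSS _ (leqnn n)).
rewrite -coef_prod_exp_monomial.
have XX (j : 'I_d) c : 'X %| (c *: 'X^(j.*2.+1) : {poly R}).
  by rewrite -mul_polyC dvdp_mull // exprS dvdp_mulr.
apply: (has_log_deriv_unique (has_log_deriv_prod _ (fun k => has_log_deriv_cayley n (a k)))
  (has_log_deriv_prod _ (fun j => has_log_deriv_exp n (XX j _)))) => [i ni||] //.
  rewrite !coef_sum.
  rewrite (eq_bigr (fun k => if odd i then 0 else 2 * a k ^+ i.+1)); last first.
    by move=> k _; rewrite coef_cayley_log_deriv // ltnW.
  rewrite (eq_bigr (fun j : 'I_d => if j.*2 == i
      then 2 * \sum_(1 <= k < N.+1) a k ^+ j.*2.+1 else 0)); last first.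
    move=> j _; rewrite derivZ derivXn coefZ coefMn coefXn /= eq_sym.
    case: ifP => _; rewrite ?mul0rn ?mulr0 //.
    by rewrite divfK // pnatr_eq0.
  rewrite -big_mkcond /=; have [io|ie] := boolP (odd i).
    rewrite big1 // big1 // => j /eqP ji.
    by move: io; rewrite -ji odd_double.
  have i2 : i./2.*2 = i by rewrite -[RHS]odd_double_half (negbTE ie).
  have id : (i./2 < d)%N by rewrite -ltn_double i2 -muln2 mulnC (leq_trans ni).
  rewrite (big_pred1 (Ordinal id)) ?i2 ?mulr_sumr //= ?i2 ?mulr_sumr // => j.
  by rewrite -{1}i2 (inj_eq double_inj).
rewrite coef_prod_cayley0 coef0_prod big1 // => j _.
exact: coef_exp_poly0.
Qed.

End LogDerivative.

(** * Moments of powers of the cosine on a quarter period *)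

Section WallisMoments.
Local Open Scope classical_set_scope.
Variable R : realType.
Notation mu := (@lebesgue_measure R).
Notation quarter := (`[0, pi / 2] : set R).

Lemma pihalf_gt0 : 0 < pi / 2 :> R.
Proof. by rewrite divr_gt0 ?pi_gt0. Qed.

Lemma is_derive1_mul (f g : R -> R) (x df dg : R) :
  is_derive x 1 f df -> is_derive x 1 g dg ->
  is_derive x 1 (fun t => f t * g t) (f x * dg + g x * df).
Proof. by move=> hf hg; exact: is_deriveM. Qed.

Lemma is_derive1_add (f g : R -> R) (x df dg : R) :
  is_derive x 1 f df -> is_derive x 1 g dg ->
  is_derive x 1 (fun t => f t + g t) (df + dg).
Proof. by move=> hf hg; exact: is_deriveD. Qed.

Lemma is_derive1_scale (f : R -> R) (c x df : R) :
  is_derive x 1 f df -> is_derive x 1 (fun t => c * f t) (c * df).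
Proof. by move=> hf; exact: is_deriveZ. Qed.

Lemma is_derive1_pow (f : R -> R) n (x df : R) : is_derive x 1 f df ->
  is_derive x 1 (fun t => f t ^+ n) (n%:R * f x ^+ n.-1 * df).
Proof.
move=> hf; have := @is_deriveX _ _ f n x 1 df hf; rewrite exprfctE.
exact.
Qed.

Lemma is_derive1_powid n (x : R) : is_derive x 1 (fun t : R => t ^+ n) (n%:R * x ^+ n.-1).
Proof. by rewrite -[X in is_derive _ _ _ X]mulr1; exact: is_derive1_pow. Qed.

Lemma ftc_quarter (f F : R -> R) : continuous f ->
  (forall x : R, is_derive x 1 F (f x)) ->
  \int[mu]_(x in quarter) f x = F (pi / 2) - F 0.
Proof.
move=> cf dF.
have cF : continuous F.
  by move=> x; apply/differentiable_continuous/derivable1_diffP; case: (dF x).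
rewrite /Rintegral (continuous_FTC2 (F := F) pihalf_gt0) //.
- exact: continuous_subspaceT.
- split => [x _||]; first by case: (dF x).
    by apply: cvg_at_right_filter; exact: cF.
  by apply: cvg_at_left_filter; exact: cF.
- by move=> x _; rewrite derive1E; have -> := @derive_val _ _ _ _ _ _ _ (dF x).
Qed.

Lemma continuous_quarter_integrable (f : R -> R) : continuous f ->
  mu.-integrable quarter (EFin \o f).
Proof.
move=> cf; apply: continuous_compact_integrable; first exact: segment_compact.
exact: continuous_subspaceT.
Qed.

Lemma continuous_cosX_powX e p : continuous (fun t : R => cos t ^+ e * t ^+ p).
Proof.
move=> t; apply: cvgM.
  apply: (@continuous_comp _ _ _ cos (fun x => x ^+ e)); first exact: continuous_cos.
  exact: exprn_continuous.
exact: exprn_continuous.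
Qed.

Definition wallis_moment e p : R := \int[mu]_(t in quarter) (cos t ^+ e * t ^+ p).

Lemma wallis_moment_ge0 e p : 0 <= wallis_moment e p.
Proof.
apply: Rintegral_ge0 => t /=; rewrite in_itv /= => /andP[t0 tp].
rewrite mulr_ge0 // exprn_ge0 // cos_ge0_pihalf // tp andbT.
by rewrite (le_trans _ t0) // oppr_le0 ltW // pihalf_gt0.
Qed.

Lemma wallis_moment0l p : p.+1%:R * wallis_moment 0 p = (pi / 2) ^+ p.+1.
Proof.
have -> : wallis_moment 0 p = p.+1%:R^-1 * (pi / 2) ^+ p.+1 - p.+1%:R^-1 * 0 ^+ p.+1.
  apply: (@ftc_quarter _ (fun t => p.+1%:R^-1 * t ^+ p.+1)); last first.
    move=> x; apply: is_derive_eq (is_derive1_scale _ (is_derive1_powid _ _)) _.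
    by rewrite expr0 mul1r /= mulKf // pnatr_eq0.
  exact: continuous_cosX_powX.
by rewrite expr0n mulr0 subr0 mulVKf // pnatr_eq0.
Qed.

(** The fundamental theorem of calculus on the span of the functions cos^e t^p; three
    terms are what the recurrences below use. *)
Lemma wallis_moment_lin e p a e' p' b e'' p'' c (F : R -> R) :
  (forall x : R, is_derive x 1 F (a * (cos x ^+ e * x ^+ p) + b * (cos x ^+ e' * x ^+ p') +
     c * (cos x ^+ e'' * x ^+ p''))) ->
  a * wallis_moment e p + b * wallis_moment e' p' + c * wallis_moment e'' p'' =
  F (pi / 2) - F 0.
Proof.
have cont d k q : continuous (fun x : R => d * (cos x ^+ k * x ^+ q)).
  by move=> x; apply: cvgM; [exact: cst_continuous|exact: continuous_cosX_powX].
move=> dF; rewrite -(ftc_quarter _ dF); last first.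
  by move=> x; do 2?apply: cvgD; exact: cont.
have mq : measurable quarter by [].
rewrite RintegralD //; last first.
- exact: continuous_quarter_integrable.
- by apply: continuous_quarter_integrable => x; apply: cvgD; exact: cont.
rewrite RintegralD //; do ?exact: continuous_quarter_integrable.
by rewrite !RintegralZl //; exact/continuous_quarter_integrable/continuous_cosX_powX.
Qed.

(** Two integrations by parts: the boundary terms vanish at 0 because of the power
    of t and at pi/2 because of the power of the cosine. *)
Lemma wallis_moment_rec e p :
  (p.+2 * p.+1)%:R * wallis_moment e.+2 p =
  (e.+2 * e.+1)%:R * wallis_moment e p.+2 - e.+2%:R ^+ 2 * wallis_moment e.+2 p.+2.
Proof.
pose F (t : R) := p.+2%:R * (cos t ^+ e.+2 * t ^+ p.+1) +
  e.+2%:R * (cos t ^+ e.+1 * sin t * t ^+ p.+2).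
suff H : (p.+2 * p.+1)%:R * wallis_moment e.+2 p +
    (- (e.+2 * e.+1)%:R) * wallis_moment e p.+2 +
    e.+2%:R ^+ 2 * wallis_moment e.+2 p.+2 = 0.
  by apply/subr0_eq; rewrite -[RHS]H; ring.
transitivity (F (pi / 2) - F 0); last first.
  by rewrite /F cos_pihalf !exprS !mul0r !mulr0 addr0 subr0.
apply: wallis_moment_lin.
move=> x; apply: is_derive_eq (is_derive1_add
  (is_derive1_scale _ (is_derive1_mul
     (is_derive1_pow _ (is_derive_cos x)) (is_derive1_powid _ x)))
  (is_derive1_scale _ (is_derive1_mul
     (is_derive1_mul (is_derive1_pow _ (is_derive_cos x)) (is_derive_sin x))
     (is_derive1_powid _ x)))) _.
have := cos2Dsin2 x; set c := cos x; set s := sin x; rewrite /= => /esym cs.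
rewrite -[LHS]addr0 -[X in _ + X](mulr0 ((e.+2 * e.+1)%:R * (c ^+ e * x ^+ p.+2))).
rewrite -(subrr 1) [X in _ * (X - _)]cs !natrM !exprS; ring.
Qed.

Lemma wallis_moment_rec0 e :
  (e.+2 * e.+1)%:R * wallis_moment e 0 = e.+2%:R ^+ 2 * wallis_moment e.+2 0.
Proof.
pose F (t : R) := e.+2%:R * (cos t ^+ e.+1 * sin t).
suff H : 0 * wallis_moment 0 0 + (- (e.+2 * e.+1)%:R) * wallis_moment e 0 +
    e.+2%:R ^+ 2 * wallis_moment e.+2 0 = 0.
  by apply/esym/subr0_eq; rewrite -[RHS]H; ring.
transitivity (F (pi / 2) - F 0); last first.
  by rewrite /F cos_pihalf sin0 exprS !mul0r !mulr0 subr0.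
apply: wallis_moment_lin.
move=> x; apply: is_derive_eq (is_derive1_scale _
  (is_derive1_mul (is_derive1_pow _ (is_derive_cos x)) (is_derive_sin x))) _.
have := cos2Dsin2 x; set c := cos x; set s := sin x; rewrite /= => /esym cs.
rewrite -[LHS]addr0 -[X in _ + X](mulr0 ((e.+2 * e.+1)%:R * c ^+ e)).
rewrite -(subrr 1) [X in _ * (X - _)]cs !natrM !exprS; ring.
Qed.

Lemma wallis_moment_gt0 N : 0 < wallis_moment (2 * N) 0.
Proof.
elim: N => [|N IH].
  by have := wallis_moment0l 0; rewrite mul1r expr1 => ->; exact: pihalf_gt0.
have h : (2 * N.+1 = (2 * N).+2)%N by rewrite mulnS.
rewrite h -(pmulr_rgt0 _ (_ : 0 < (2 * N).+2%:R ^+ 2)) ?exprn_gt0 ?ltr0n //.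
by rewrite -wallis_moment_rec0 mulr_gt0 // ltr0n.
Qed.

(** The mean of (2t)^(2j) / (2j)! for the density proportional to cos^(2N) on
    [0, pi/2]. *)
Definition scaled_moment N j : R :=
  4 ^+ j / ((2 * j)`!)%:R * (wallis_moment (2 * N) (2 * j) / wallis_moment (2 * N) 0).

Lemma scaled_moment_n0 N : scaled_moment N 0 = 1.
Proof.
by rewrite /scaled_moment muln0 fact0 expr0 !divr1 mul1r divff // gt_eqF ?wallis_moment_gt0.
Qed.

Lemma scaled_moment_0n j : scaled_moment 0 j = pi ^+ (2 * j) / ((2 * j).+1`!)%:R.
Proof.
have p0 : pi / 2 != 0 :> R by rewrite gt_eqF // pihalf_gt0.
have e p : wallis_moment 0 p = (pi / 2) ^+ p.+1 / p.+1%:R.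
  by rewrite -wallis_moment0l mulrC mulKf // pnatr_eq0.
rewrite /scaled_moment muln0 !e divr1 expr1 exprSr factS natrM.
have -> : (4 : R) = 2 ^+ 2 by rewrite -natrX.
have n1 : (2 * j).+1%:R != 0 :> R by rewrite pnatr_eq0.
have fj : ((2 * j)`!)%:R != 0 :> R by rewrite pnatr_eq0 -lt0n fact_gt0.
have t0 : 2 ^+ (2 * j) != 0 :> R by rewrite expf_neq0 // pnatr_eq0.
rewrite -exprM expr_div_n; move: n1 fj t0 p0.
move: (_%:R) (_%:R) (2 ^+ _) (pi / 2) (pi ^+ _) => x y z u v x0 y0 z0 u0.
by field; rewrite x0 y0 z0 u0.
Qed.

(** The generating series M_N = \sum_j (scaled_moment N j) x^j satisfies
    M_(N-1) = (1 + x/N^2) M_N; at N = 0 this unrolls into Euler's product for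
    sinh(pi y) / (pi y), where x = y^2. *)
Lemma scaled_moment_rec N j :
  scaled_moment N j.+1 = scaled_moment N.+1 j.+1 + scaled_moment N.+1 j / N.+1%:R ^+ 2.
Proof.
have h N' : (2 * N'.+1 = (2 * N').+2)%N by rewrite mulnS.
have := wallis_moment_rec (2 * N) (2 * j); have := wallis_moment_rec0 (2 * N).
have := wallis_moment_gt0 N; have := wallis_moment_gt0 N.+1.
rewrite /scaled_moment !h !factS !natrM.
have -> : (2 * N).+2%:R = 2 * N.+1%:R :> R by rewrite -natrM mulnS.
have fj : ((2 * j)`!)%:R != 0 :> R by rewrite pnatr_eq0 -lt0n fact_gt0.
move: fj; move: ((2 * j)`!)%:R => fj fj0.
have : N.+1%:R != 0 :> R by rewrite pnatr_eq0.
have : (2 * N).+1%:R != 0 :> R by rewrite pnatr_eq0.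
have : (2 * j).+1%:R != 0 :> R by rewrite pnatr_eq0.
have : (2 * j).+2%:R != 0 :> R by rewrite pnatr_eq0.
move: (wallis_moment (2 * N) 0) (wallis_moment (2 * N).+2 0) => a b.
move: (wallis_moment _ _) (wallis_moment _ _) (wallis_moment _ _) => A B C.
rewrite [4 ^+ _]exprS; move: (4 ^+ j) (_ .+1%:R) (_.+1%:R) (_.+1%:R) (_.+2%:R).
move=> w n n' p p' p0' p0 n0' n0 /lt0r_neq0 b0 /lt0r_neq0 a0 e1 e2.
have -> : a = 2 * n * b / n'.
  by apply: (mulfI (mulf_neq0 (mulf_neq0 (_ : 2 != 0 :> R) n0) n0')) => //; rewrite e1; field.
have -> : B = (p' * p * C + 2 * n * (2 * n) * A) / (2 * n * n').
  rewrite e2; field.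
  by rewrite n0' n0.
by field; rewrite n0 n0' b0 fj0 p0 p0'.
Qed.

Lemma le_mul_cos_sin (t : R) : 0 <= t -> t <= pi / 2 -> t * cos t <= sin t.
Proof.
move=> t0 tp; rewrite -subr_ge0.
(* g' t = t sin t is nonnegative on the interval *)
pose g (t : R) := sin t + (-1) * (t * cos t).
have dg (x : R) : is_derive x 1 g (x * sin x).
  apply: is_derive_eq (is_derive1_add (is_derive_sin x) (is_derive1_scale (-1)
    (is_derive1_mul (is_derive_id x 1) (is_derive_cos x)))) _.
  by ring.
have cg : continuous g.
  by move=> x; apply/differentiable_continuous/derivable1_diffP; case: (dg x).
have <- : g t = sin t - t * cos t by rewrite /g mulN1r.
have <- : g 0 = 0 by rewrite /g sin0 mul0r mulr0 addr0.
apply: (@ger0_derive1_ndecr R g 0 (pi / 2)) => //.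
- move=> x; rewrite in_itv /= => /andP[x0 xp].
  rewrite derive1E; have -> := @derive_val _ _ _ _ _ _ _ (dg x).
  rewrite mulr_ge0 ?ltW // sin_gt0_pihalf // x0 xp //.
- exact: continuous_subspaceT.
Qed.

(** Integrate (t cos t)^2 <= (sin t)^2 = 1 - (cos t)^2 against cos^e. *)
Lemma wallis_moment2_le e : wallis_moment e.+2 2 <= wallis_moment e 0 - wallis_moment e.+2 0.
Proof.
have ic k p := continuous_quarter_integrable (@continuous_cosX_powX k p).
rewrite /wallis_moment -RintegralB //.
apply: le_Rintegral => //.
  by apply: continuous_quarter_integrable => x; apply: cvgB; exact: continuous_cosX_powX.
move=> t /=; rewrite in_itv /= => /andP[t0 tp].
have c0 : 0 <= cos t.
  by rewrite cos_ge0_pihalf // tp andbT (le_trans _ t0) // oppr_le0 ltW // pihalf_gt0.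
have := le_mul_cos_sin t0 tp.
rewrite -(ler_sqr (mulr_ge0 t0 c0)); last first.
  by rewrite nnegrE; apply: le_trans (le_mul_cos_sin t0 tp); rewrite mulr_ge0.
rewrite sin2cos2 exprMn => h; rewrite !expr0 !mulr1 -[X in _ <= X - _]mulr1.
have -> : cos t ^+ e.+2 = cos t ^+ e * cos t ^+ 2 by rewrite -exprD addn2.
by rewrite -mulrBr -mulrA ler_wpM2l ?exprn_ge0 // mulrC.
Qed.

Lemma wallis_moment_leM e p q : wallis_moment e (p + q) <= (pi / 2) ^+ q * wallis_moment e p.
Proof.
have ic k r := continuous_quarter_integrable (@continuous_cosX_powX k r).
rewrite /wallis_moment -RintegralZl //.
apply: le_Rintegral => //.
  by apply: continuous_quarter_integrable => x; apply: cvgMl_tmp; exact: continuous_cosX_powX.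
move=> t /=; rewrite in_itv /= => /andP[t0 tp].
have c0 : 0 <= cos t.
  by rewrite cos_ge0_pihalf // tp andbT (le_trans _ t0) // oppr_le0 ltW // pihalf_gt0.
rewrite exprD mulrA mulrC ler_wpM2r ?mulr_ge0 ?exprn_ge0 //.
by rewrite lerXn2r // nnegrE ltW // pihalf_gt0.
Qed.

(** The mass of cos^(2N) concentrates near 0: its second moment is O(1/N), and the
    higher moments are bounded by the second one. *)
Lemma scaled_moment_le j : exists C : R, forall N,
  0 <= scaled_moment N.+1 j.+1 <= C / N.+1%:R.
Proof.
exists (4 ^+ j.+1 / ((2 * j.+1)`!)%:R * (pi / 2) ^+ (2 * j)) => N.
have K0 : 0 <= 4 ^+ j.+1 / ((2 * j.+1)`!)%:R :> R by rewrite divr_ge0 // exprn_ge0.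
have h N' : (2 * N'.+1 = (2 * N').+2)%N by rewrite mulnS.
have m1 := wallis_moment_gt0 N.+1.
rewrite /scaled_moment mulr_ge0 ?divr_ge0 ?wallis_moment_ge0 ?(ltW m1) //=.
rewrite -[leRHS]mulrA ler_wpM2l // ler_pdivrMr // [(2 * j.+1)%N]mulnS.
apply: le_trans (wallis_moment_leM _ _ _) _; rewrite -mulrA ler_wpM2l //.
  by rewrite exprn_ge0 // ltW // pihalf_gt0.
rewrite ler_pdivlMl ?ltr0n //.
have := wallis_moment_rec0 (2 * N); have := wallis_moment2_le (2 * N).
rewrite -!h; move: m1; move: (wallis_moment _ _) (wallis_moment _ _) (wallis_moment _ _).
move=> a x b b0 xab; have -> : (2 * N.+1)%:R = 2 * N.+1%:R :> R by rewrite natrM.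
rewrite natrM natrM; have -> : (2 * N).+1%:R = 2 * N.+1%:R - 1 :> R.
  by rewrite -!natr1 natrM; ring.
have : 1 <= N.+1%:R :> R by rewrite ler1n.
move: N.+1%:R => n n1 e.
have qa : (2 * n - 1) * a = 2 * n * b.
  have n0 : n != 0 by rewrite gt_eqF // (lt_le_trans _ n1).
  apply: (mulfI (mulf_neq0 (_ : 2 != 0 :> R) n0)) => //.
  by rewrite mulrA e; ring.
apply: (@le_trans _ _ (n * (a - b))); first by rewrite ler_wpM2l // (le_trans _ n1).
have q0 : 0 < 2 * n - 1 by lra.
rewrite -subr_ge0 -(pmulr_rge0 _ q0).
have -> : (2 * n - 1) * (b - n * (a - b)) =
  (2 * n - 1) * b - n * ((2 * n - 1) * a) + n * (2 * n - 1) * b by ring.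
have -> : (2 * n - 1) * b - n * ((2 * n - 1) * a) + n * (2 * n - 1) * b = b * (n - 1).
  by rewrite qa; ring.
by rewrite (mulr_ge0 (ltW b0)) // subr_ge0.
Qed.

Lemma scaled_moment_cvg0 j : (scaled_moment ^~ j.+1) @ \oo --> (0 : R).
Proof.
have [C hC] := scaled_moment_le j.
rewrite -cvg_shiftS /=; apply: (@squeeze_cvgr _ _ _ _ (cst 0) (fun N => C / N.+1%:R)).
- by apply: nearW => N; exact: hC.
- exact: cvg_cst.
- rewrite -[X in _ --> X](mulr0 C); apply: cvgMl_tmp; exact: cvg_harmonic.
Qed.
End WallisMoments.

(** * Power series near zero and the Bernoulli numbers *)

Section PowerSeries.
Local Open Scope classical_set_scope.
Variable R : realType.
Implicit Types (u v d : nat -> R).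

Lemma near0_pos (P : R -> Prop) : (\forall t \near (0 : R)^', P t) ->
  exists2 e : R, 0 < e & forall t, 0 < t < e -> P t.
Proof.
move=> -[e /= e0 he]; exists e => // t /andP[t0 te]; apply: he => /=.
  by rewrite sub0r normrN gtr0_norm.
by rewrite gt_eqF.
Qed.

Lemma series_terms_bounded u (l : R) : series u @ \oo --> l ->
  exists2 K, 0 < K & forall n, `|u n| <= K.
Proof.
move=> ul; have /cvg_series_bounded [K [Kr hK]] : cvgn (series u) by apply/cvg_ex; exists l.
exists (`|K| + 1); first by rewrite ltr_wpDl.
by move=> n; apply: (hK (`|K| + 1)) => //; rewrite (le_lt_trans (ler_norm _)) // ltrDl.
Qed.

(** The ratio 1/4 is an arbitrary choice; convergence near 0 provides it after
    shrinking the argument. *)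
Lemma geometric_tail u (C : R) k m : (forall n, `|u n| <= C * 4^-1 ^+ n) ->
  `|series u (k + m)%N - series u k| <= C * (2 * 4^-1 ^+ k - 2 * 4^-1 ^+ (k + m)).
Proof.
move=> hu; elim: m => [|m IH]; first by rewrite addn0 !subrr normr0 mulr0.
rewrite addnS seriesSr addrAC; apply: le_trans (ler_normD _ _) _.
apply: le_trans (lerD IH (hu _)) _; rewrite -mulrDr.
have C0 : 0 <= C by have := hu 0%N; rewrite expr0 mulr1; apply: le_trans.
rewrite ler_wpM2l // exprS; have : 0 <= 4^-1 ^+ (k + m) :> R by rewrite exprn_ge0.
lra.
Qed.

Definition convolution u v n := \sum_(i < n.+1) u i * v (n - i)%N.

Lemma series_convolution u v N :
  series (convolution u v) N = \sum_(i < N) u i * series v (N - i)%N.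
Proof.
elim: N => [|N IH]; first by rewrite /series /= big_geq // big_ord0.
rewrite seriesSr IH [RHS]big_ord_recr /= subSnn /convolution big_ord_recr /= subnn.
rewrite addrA -big_split /=; congr (_ + _); last by rewrite /series /= big_nat1.
by apply: eq_bigr => i _; rewrite subSn ?seriesSr ?mulrDr // ltnW.
Qed.

(** The product of the partial sums differs from the partial sum of the convolution by
    the u_i v_j with i, j < N <= i + j; for each of the N values of i they add up to
    at most 2 C D 4^(-N). *)
Lemma cauchy_product_cvg u v (C D a b : R) :
  (forall n, `|u n| <= C * 4^-1 ^+ n) -> (forall n, `|v n| <= D * 4^-1 ^+ n) ->
  series u @ \oo --> a -> series v @ \oo --> b ->
  series (convolution u v) @ \oo --> a * b.
Proof.
move=> hu hv ua vb.
have C0 : 0 <= C by have := hu 0%N; rewrite expr0 mulr1; apply: le_trans.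
have D0 : 0 <= D by have := hv 0%N; rewrite expr0 mulr1; apply: le_trans.
have hd N : `|series u N * series v N - series (convolution u v) N| <= C * D * 2 * 2^-1 ^+ N.
  rewrite series_convolution {1}/series /= big_mkord mulr_suml -sumrB.
  apply: le_trans (ler_norm_sum _ _ _) _.
  apply: (@le_trans _ _ (\sum_(i < N) C * D * 2 * 4^-1 ^+ N)).
    apply: ler_sum => i _; rewrite -mulrBr normrM.
    have e : 4^-1 ^+ N = 4^-1 ^+ i * 4^-1 ^+ (N - i) :> R by rewrite -exprD subnKC // ltnW.
    have -> : C * D * 2 * 4^-1 ^+ N = (C * 4^-1 ^+ i) * (D * (2 * 4^-1 ^+ (N - i))).
      by rewrite e; ring.
    apply: ler_pM => //; have := geometric_tail (N - i) i hv.
    rewrite subnK ?(ltnW (ltn_ord i)) // => /le_trans; apply.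
    by rewrite ler_wpM2l // gerBl mulr_ge0 // exprn_ge0.
  rewrite sumr_const card_ord -mulrnAr ler_wpM2l ?mulr_ge0 //.
  have -> : (4^-1 : R) = 2^-1 * 2^-1 by field.
  rewrite exprMn -mulrnAl -[leRHS]mul1r ler_wpM2r ?exprn_ge0 //.
  rewrite -[2^-1 ^+ N *+ N]mulr_natl exprVn ler_pdivrMr ?exprn_gt0 // mul1r -natrX ler_nat.
  exact/ltnW/ltn_expl.
have cd : (fun N => series u N * series v N - series (convolution u v) N) @ \oo --> (0 : R).
  apply/norm_cvg0P; apply: (@squeeze_cvgr _ _ _ _ (cst 0) (fun N => C * D * 2 * 2^-1 ^+ N)).
  - by apply: nearW => N; rewrite normr_ge0 /= hd.
  - exact: cvg_cst.
  - rewrite -[X in _ --> X](mulr0 (C * D * 2)); apply: cvgMl_tmp.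
    by apply: cvg_expr; rewrite ger0_norm // invf_lt1 // ltr1n.
rewrite (_ : series _ = fun N => series u N * series v N -
    (series u N * series v N - series (convolution u v) N)); last first.
  by apply/funext => N; ring.
by rewrite -[a * b]subr0; apply: cvgB cd; exact: cvgM.
Qed.

(** The terms of degree at least 1 contribute O(t) uniformly in the number of terms,
    while the whole sum tends to 0. *)
Lemma pseries_zero_coef0 d (e : R) : 0 < e ->
  (forall t : R, 0 < t < e -> series (fun s => d s * t ^+ s) @ \oo --> (0 : R)) -> d 0%N = 0.
Proof.
move=> e0 hd; pose t0 := e / 2.
have t00 : 0 < t0 by rewrite divr_gt0.
have t0e : 0 < t0 < e by rewrite t00 /t0 /=; lra.
have [K K0 hK] := series_terms_bounded (hd _ t0e).
have bound (t : R) : 0 < t <= t0 / 4 -> `|d 0%N| <= t * (2 * K / t0).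
  move=> /andP[tpos tt0].
  have te : 0 < t < e by rewrite tpos /=; move: tt0; rewrite /t0; lra.
  pose w s := d s.+1 * t ^+ s.+1.
  have hw s : `|w s| <= (K * (t / t0)) * 4^-1 ^+ s.
    have -> : w s = (d s.+1 * t0 ^+ s.+1) * ((t / t0) * (t / t0) ^+ s).
      rewrite -exprS /w [(t / _) ^+ _]expr_div_n; have := lt0r_neq0 (exprn_gt0 s.+1 t00).
      by move: (t ^+ _) (t0 ^+ _) => x y y0; field.
    have r0 : 0 <= t / t0 by rewrite divr_ge0 // ltW.
    rewrite normrM -[leRHS]mulrA; apply: ler_pM => //.
    rewrite (ger0_norm (mulr_ge0 r0 (exprn_ge0 s r0))); apply: (ler_wpM2l r0).
    by rewrite lerXn2r ?nnegrE // ler_pdivrMr // mulrC.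
  have hs : series (fun s => d s * t ^+ s) \o S = fun N => d 0%N + series w N.
    apply/funext => N /=; rewrite /series /= big_nat_recl //= expr0 mulr1.
    by [].
  have := hd _ te; rewrite -cvg_shiftS -/(_ \o S) hs => cw.
  have cn : (fun N => `|d 0%N + series w N - d 0%N|) @ \oo --> `|d 0%N|.
    have <- : `|0 - d 0%N| = `|d 0%N| by rewrite sub0r normrN.
    apply: cvg_norm; apply: cvgB; [exact: cw|exact: cvg_cst].
  apply: (cvgr_to_le cn); apply: nearW => N.
  rewrite addrAC subrr add0r -[N]add0n.
  have := geometric_tail 0 N hw; rewrite [in X in `|_ - X|]/series /= big_geq // subr0.
  move=> /le_trans; apply; rewrite expr0 mulr1.
  have -> : t * (2 * K / t0) = K * (t / t0) * 2 by ring.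
  have r0 : 0 <= K * (t / t0) by rewrite mulr_ge0 ?divr_ge0 ?ltW.
  apply: (ler_wpM2l r0); rewrite gerBl.
  by rewrite mulr_ge0 // exprn_ge0.
apply/eqP; case: eqVneq => // d0; rewrite -normr_gt0 in d0.
have M0 : 0 < 2 * K / t0 by rewrite divr_gt0 ?mulr_gt0.
(* small enough for the bound at t to be at most half of |d 0| *)
pose t := Num.min (t0 / 4) (`|d 0%N| / (2 * (2 * K / t0))).
have tP : 0 < t <= t0 / 4.
  have q1 : 0 < t0 / 4 by rewrite divr_gt0.
  have q2 : 0 < `|d 0%N| / (2 * (2 * K / t0)) by rewrite divr_gt0 // mulr_gt0.
  by rewrite /t lt_min q1 q2 ge_min lexx.
have := bound t tP; rewrite leNgt => /negP[].
apply: (@le_lt_trans _ _ (`|d 0%N| / (2 * (2 * K / t0)) * (2 * K / t0))).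
  by rewrite ler_wpM2r ?(ltW M0) // /t ge_min lexx orbT.
move: M0; move: (2 * K / t0) => M M0.
have -> : `|d 0%N| / (2 * M) * M = `|d 0%N| / 2 by field; rewrite gt_eqF.
by rewrite ltr_pdivrMr // ltr_pMr // ltr1n.
Qed.

Lemma pseries_zero_coef d (e : R) : 0 < e ->
  (forall t : R, 0 < t < e -> series (fun s => d s * t ^+ s) @ \oo --> (0 : R)) ->
  forall n, d n = 0.
Proof.
move=> e0 hd n; elim: n d hd => [|n IH] d hd; first exact: pseries_zero_coef0 hd.
have d0 := pseries_zero_coef0 e0 hd.
apply: (IH (fun s => d s.+1)) => t te; have /andP[t0 _] := te.
have h := hd t te; rewrite -cvg_shiftS in h.
rewrite (_ : series _ = fun N => series (fun s => d s * t ^+ s) N.+1 * t^-1).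
  by rewrite -[X in _ --> X](mul0r t^-1); apply: cvgMr_tmp.
apply/funext => N; rewrite /series /= big_nat_recl //= d0 mul0r add0r mulr_suml.
by apply: eq_bigr => i _; rewrite exprSr mulrA mulfK // gt_eqF.
Qed.

End PowerSeries.

Section Bernoulli.
Local Open Scope classical_set_scope.
Variable R : realType.

(** The coefficients of t / sinh t. *)
Definition csch_coef (B : nat -> R) (s : nat) : R := (2 - 2 ^+ s) * B s / (s`!)%:R.

(** The coefficients of sinh t / t. *)
Definition sinhc_coef (s : nat) : R := if odd s then 0 else ((s.+1)`!)%:R^-1.

Lemma sinhc_series (t : R) : t != 0 ->
  series (fun s => sinhc_coef s * t ^+ s) @ \oo --> (expR t - expR (- t)) / (2 * t).
Proof.
move=> t0.
rewrite (_ : series _ = fun N =>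
    (series (exp_coeff t) N.+1 - series (exp_coeff (- t)) N.+1) / (2 * t)).
  have c (x : R) : (fun N => series (exp_coeff x) N.+1) @ \oo --> expR x.
    have : series (exp_coeff x) @ \oo --> expR x by exact: is_cvg_series_exp_coeff.
    by rewrite -cvg_shiftS.
  by apply: cvgMr_tmp; apply: cvgB; exact: c.
apply/funext => N; rewrite /series /= -sumrB big_nat_recl //=.
rewrite /exp_coeff /= !expr0 subrr add0r mulr_suml; apply: eq_bigr => i _.
rewrite /sinhc_coef -mulrBl exprNn -signr_odd /=; case: (odd i) => /=.
  by rewrite expr0 mul1r subrr !mul0r.
rewrite expr1 mulN1r opprK exprS; field.
by rewrite t0 /= pnatr_eq0 -lt0n fact_gt0.
Qed.

Lemma sinhc_coef_le s : `|sinhc_coef s| <= 1.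
Proof.
rewrite /sinhc_coef; case: odd; rewrite ?normr0 // ger0_norm ?invr_ge0 //.
by rewrite invf_le1 ?ltr0n ?ler1n fact_gt0.
Qed.

Variable B : nat -> R.
Hypothesis hB : bernoulli_numbers B.

(** t / sinh t = 2 t / (e^t - 1) - 2 t / (e^(2t) - 1), and the second term is the
    Bernoulli series at 2t. *)
Lemma csch_series : exists2 e : R, 0 < e & forall t, 0 < t < e ->
  series (fun s => csch_coef B s * t ^+ s) @ \oo --> 2 * t / (expR t - expR (- t)).
Proof.
have [e e0 he] := near0_pos hB.
(* both t and 2 t have to lie in the domain of the Bernoulli series *)
exists (e / 2); first by rewrite divr_gt0.
move=> t /andP[t0 te].
have t1 : 0 < t < e by rewrite t0 /=; lra.
have t2 : 0 < 2 * t < e by rewrite mulr_gt0 //=; lra.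
have E1 : expR t - 1 != 0 by rewrite subr_eq0 -expR0 (inj_eq (@expR_inj _)) gt_eqF.
have E2 : expR t + 1 != 0 by rewrite gt_eqF // addr_gt0 ?expR_gt0.
have E0 : expR t != 0 by rewrite gt_eqF // expR_gt0.
have -> : 2 * t / (expR t - expR (- t)) =
    2 * (t / (expR t - 1)) - 2 * t / (expR (2 * t) - 1).
  rewrite expRN mulr_natl mulr2n expRD.
  have -> : expR t * expR t - 1 = (expR t - 1) * (expR t + 1) by ring.
  have -> : expR t - (expR t)^-1 = (expR t - 1) * (expR t + 1) / expR t by field.
  by field; rewrite E0 E1 E2.
rewrite (_ : series _ = fun N => 2 * series (fun s => B s * t ^+ s / (s`!)%:R) N
    - series (fun s => B s * (2 * t) ^+ s / (s`!)%:R) N).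
  by apply: cvgB; [apply: cvgMl_tmp|]; exact: he.
apply/funext => N; rewrite /series /= mulr_sumr -sumrB; apply: eq_bigr => s _.
by rewrite /csch_coef exprMn; ring.
Qed.

Lemma csch_sinhc_convolution n :
  convolution (csch_coef B) sinhc_coef n = (n == 0%N)%:R.
Proof.
have [e e0 he] := csch_series.
have t0 : 0 < e / 2 < e by rewrite divr_gt0 //=; lra.
have [K K0 hK] := series_terms_bounded (he _ t0).
apply/eqP; rewrite -subr_eq0; apply/eqP.
(* |t| <= e / 8 makes the first series decay at rate 1/4, from its boundedness at
   e / 2, and |t| <= 1/4 the second one *)
pose e' := Num.min (e / 8) 4^-1.
have e'0 : 0 < e'.
  have e8 : 0 < e / 8 by rewrite divr_gt0.
  by rewrite /e' lt_min e8 invr_gt0 ltr0n.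
apply: (pseries_zero_coef
  (d := fun n => convolution (csch_coef B) sinhc_coef n - (n == 0%N)%:R) e'0).
move=> {n} t /andP[tpos]; rewrite /e' lt_min => /andP[te t4].
have t1 : 0 < t < e by rewrite tpos /=; lra.
have cP : series (convolution (fun s => csch_coef B s * t ^+ s)
    (fun s => sinhc_coef s * t ^+ s)) @ \oo
    --> 2 * t / (expR t - expR (- t)) * ((expR t - expR (- t)) / (2 * t)).
  apply: (@cauchy_product_cvg _ _ _ K 1).
  - move=> s.
    have -> : csch_coef B s * t ^+ s = csch_coef B s * (e / 2) ^+ s * (t / (e / 2)) ^+ s.
      rewrite [(t / _) ^+ _]expr_div_n; have := lt0r_neq0 (exprn_gt0 s (andP t0).1).
      by move: (t ^+ _) ((e / 2) ^+ _) => x y y0; field.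
    have r0 : 0 <= t / (e / 2) by rewrite divr_ge0 // ?divr_ge0 // ltW.
    rewrite normrM; apply: ler_pM => //; rewrite (ger0_norm (exprn_ge0 s r0)).
    rewrite lerXn2r ?nnegrE // ler_pdivrMr ?divr_gt0 //; lra.
  - move=> s; have tp := ltW tpos; rewrite normrM; apply: ler_pM => //.
      exact: sinhc_coef_le.
    by rewrite (ger0_norm (exprn_ge0 s tp)) lerXn2r ?nnegrE // ltW.
  - exact: he.
  - by apply: sinhc_series; rewrite gt_eqF.
have e1 : 2 * t / (expR t - expR (- t)) * ((expR t - expR (- t)) / (2 * t)) = 1.
  rewrite mulrA divfK ?divff //; first by rewrite mulf_neq0 // gt_eqF.
  by rewrite subr_eq0 (inj_eq (@expR_inj _)) gt_eqF //; lra.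
rewrite e1 -cvg_shiftS in cP.
have ce : (fun N => series (convolution (fun s => csch_coef B s * t ^+ s)
    (fun s => sinhc_coef s * t ^+ s)) N.+1 - 1) @ \oo --> (1 - 1 : R).
  by apply: cvgB; [exact: cP|exact: cvg_cst].
rewrite subrr in ce.
suff eqN N : series
    (fun s => (convolution (csch_coef B) sinhc_coef s - (s == 0%N)%:R) * t ^+ s) N.+1 =
    series (convolution (fun s => csch_coef B s * t ^+ s)
      (fun s => sinhc_coef s * t ^+ s)) N.+1 - 1.
  by rewrite -cvg_shiftS; under eq_fun do rewrite eqN.
rewrite /series /=.
rewrite (eq_bigr (fun s => convolution (fun s => csch_coef B s * t ^+ s)
    (fun s => sinhc_coef s * t ^+ s) s - (s == 0%N)%:R * t ^+ s)).
  rewrite sumrB; congr (_ - _).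
  by rewrite big_nat_recl //= mul1r expr0 big1 ?addr0 // => i _; rewrite mul0r.
move=> s _; rewrite mulrBl; congr (_ - _); rewrite /convolution mulr_suml.
apply: eq_bigr => -[i /=]; rewrite ltnS => si _; rewrite mulrACA -exprD subnKC //.
Qed.

(** Only even indices contribute because sinh t / t is even. *)
Lemma csch_coef_rec n :
  \sum_(i < n.+1) csch_coef B (2 * i) / ((2 * (n - i)).+1`!)%:R = (n == 0%N)%:R.
Proof.
have <- : ((2 * n == 0) = (n == 0))%N by rewrite muln_eq0.
rewrite -csch_sinhc_convolution /convolution.
rewrite -(big_mkord xpredT (fun i => csch_coef B i * sinhc_coef (2 * n - i))).
rewrite -(big_mkord xpredT (fun i => csch_coef B (2 * i) / ((2 * (n - i)).+1`!)%:R)).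
have e m : (m <= n)%N -> \sum_(0 <= i < (2 * m).+1) csch_coef B i * sinhc_coef (2 * n - i) =
    \sum_(0 <= i < m.+1) csch_coef B (2 * i) / ((2 * (n - i)).+1`!)%:R.
  elim: m => [|m IH] mn.
    by rewrite !big_nat1 muln0 !subn0 /sinhc_coef mul2n odd_double.
  have h : (2 * m.+1 = (2 * m).+2)%N by rewrite mulnS.
  have lt2 : (2 * m.+1 <= 2 * n)%N by rewrite leq_mul2l.
  rewrite [RHS]big_nat_recr //= -IH ?(ltnW mn) // h !big_nat_recr //= -addrA.
  rewrite h in lt2; have lt1 := ltnW lt2.
  congr (_ + _); rewrite mulnBr h /sinhc_coef !oddB ?oddM //=.
  by rewrite !oddM /= mulr0 add0r.
by rewrite e.
Qed.

End Bernoulli.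

(** * Values of the star sums with all exponents equal to two *)

Section FiniteLimits.
Local Open Scope classical_set_scope.
Variable R : realType.
Variables (I : Type) (r : seq I) (P : pred I) (u : I -> nat -> R) (l : I -> R).
Hypothesis ul : forall i, u i @ \oo --> l i.

Lemma cvg_finite_sum :
  (fun N => \sum_(i <- r | P i) u i N) @ \oo --> \sum_(i <- r | P i) l i.
Proof. by apply: cvg_big => // ; exact: add_continuous. Qed.

Lemma cvg_finite_prod :
  (fun N => \prod_(i <- r | P i) u i N) @ \oo --> \prod_(i <- r | P i) l i.
Proof. by apply: cvg_big => // ; exact: mul_continuous. Qed.

End FiniteLimits.

Section StarTwos.
Local Open Scope classical_set_scope.
Variable R : realType.

Lemma star_sum_twosS n N : star_sum R (nseq n.+1 2%N) N.+1 =
  star_sum R (nseq n.+1 2%N) N + star_sum R (nseq n 2%N) N.+1 / N.+1%:R ^+ 2.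
Proof. by rewrite [LHS]/= big_nat_recr //= [X in _ + X]mulrC. Qed.

(** The series \sum_i (-1)^i S_N({2}^i) x^i is the product of the 1 / (1 + x/k^2)
    for k <= N, and [scaled_moment_rec] says that multiplying by it carries the
    moments at 0 to those at N. *)
Lemma scaled_moment_star_sum N n : scaled_moment R N n =
  \sum_(i < n.+1) (-1) ^+ i * star_sum R (nseq i 2%N) N * scaled_moment R 0 (n - i).
Proof.
elim: N n => [|N IHN] n.
  rewrite big_ord_recl expr0 !mul1r subn0 big1 ?addr0 // => i _.
  by rewrite /= big_geq // mulr0 mul0r.
elim: n => [|n IHn].
  by rewrite big_ord_recl big_ord0 addr0 expr0 !mul1r !scaled_moment_n0.
have -> : scaled_moment R N.+1 n.+1 =
    scaled_moment R N n.+1 - scaled_moment R N.+1 n / N.+1%:R ^+ 2.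
  by rewrite [scaled_moment R N n.+1]scaled_moment_rec addrK.
rewrite IHN IHn big_ord_recl [RHS]big_ord_recl -addrA; congr (_ + _).
rewrite mulr_suml -sumrB; apply: eq_bigr => i _.
by rewrite !lift0 star_sum_twosS subSS exprS; ring.
Qed.

Variable B : nat -> R.
Hypothesis hB : bernoulli_numbers B.

(** Letting N tend to infinity in [scaled_moment_star_sum] gives, for the limits, the
    recurrence which [csch_coef_rec] gives for the coefficients of t / sinh t. *)
Lemma star_sum_twos_cvg n :
  star_sum R (nseq n 2%N) @ \oo --> (-1) ^+ n * pi ^+ (2 * n) * csch_coef B (2 * n).
Proof.
elim/ltn_ind: n => n IH.
pose c i := (-1) ^+ i * (scaled_moment R 0 (n - i)).
have E N : star_sum R (nseq n 2%N) N = (-1) ^+ n * (scaled_moment R N n -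
    \sum_(i < n) c i * star_sum R (nseq i 2%N) N).
  rewrite scaled_moment_star_sum big_ord_recr /= subnn scaled_moment_n0 mulr1.
  rewrite (eq_bigr (fun i : 'I_n => c i * star_sum R (nseq i 2%N) N)); last first.
    by move=> i _; rewrite /c; ring.
  by rewrite addrAC subrr add0r mulrA -expr2 sqrr_sign mul1r.
rewrite (_ : star_sum R (nseq n 2%N) = fun N => (-1) ^+ n * (scaled_moment R N n -
    \sum_(i < n) c i * star_sum R (nseq i 2%N) N)); last exact/funext.
have cm : (scaled_moment R ^~ n) @ \oo --> ((n == 0%N)%:R : R).
  case: (n) => [|n']; last exact: scaled_moment_cvg0.
  rewrite (_ : (_ ^~ _) = cst 1); first exact: cvg_cst.
  by apply/funext => N; rewrite scaled_moment_n0.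
have cs : (fun N => \sum_(i < n) c i * star_sum R (nseq i 2%N) N) @ \oo -->
    \sum_(i < n) c i * ((-1) ^+ i * pi ^+ (2 * i) * csch_coef B (2 * i)).
  apply: cvg_finite_sum => i; apply: cvgMl_tmp; exact: IH.
have -> : (-1) ^+ n * pi ^+ (2 * n) * csch_coef B (2 * n) =
    (-1) ^+ n * ((n == 0%N)%:R -
      \sum_(i < n) c i * ((-1) ^+ i * pi ^+ (2 * i) * csch_coef B (2 * i))).
  rewrite -mulrA; congr (_ * _).
  have -> : (n == 0%N)%:R = pi ^+ (2 * n) * (n == 0%N)%:R :> R.
    by case: (n) => [|n'] //=; rewrite ?mulr1 ?mulr0.
  rewrite -(csch_coef_rec hB n) big_ord_recr /= subnn muln0 factS fact0 muln1 divr1.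
  rewrite mulrDr mulr_sumr addrAC -sumrB big1 ?add0r // => i _.
  apply/eqP; rewrite subr_eq0; apply/eqP.
  rewrite /c scaled_moment_0n.
  have -> : pi ^+ (2 * n) = pi ^+ (2 * i) * pi ^+ (2 * (n - i)) :> R.
    by rewrite -exprD -mulnDr subnKC // ltnW.
  move: (pi ^+ (2 * i)) (pi ^+ (2 * (n - i))) (csch_coef B (2 * i)) (_%:R^-1) => P Q K F.
  have -> : (-1) ^+ i * (Q * F) * ((-1) ^+ i * P * K) =
    ((-1) ^+ i * (-1) ^+ i) * (P * Q * (K * F)) by ring.
  by rewrite -expr2 sqrr_sign mul1r.
by apply: cvgMl_tmp; apply: cvgB.
Qed.

End StarTwos.

(** * Passage from weighted to unweighted sums *)

Section Tannery.
Local Open Scope classical_set_scope.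
Variable R : realType.
Local Notation weight := (@weight R).

Lemma weight_nonneg N k : 0 <= weight N k.
Proof.
have [Nk|kN] := ltnP N k; first by rewrite weight_gt.
apply: prodr_ge0 => i _; rewrite divr_ge0 // subr_ge0 ler_nat.
by rewrite ltnW // (leq_trans (ltn_ord i)).
Qed.

Lemma weight_le1 N k : weight N k <= 1.
Proof.
have [Nk|kN] := ltnP N k; first by rewrite weight_gt.
apply: prodr_ile1 => i _; rewrite divr_ge0 /=; last by [].
  rewrite ler_pdivrMr ?mul1r ?ltr0n ?addnS // lerBlDr -natrD ler_nat.
  by rewrite -addnS -addnA leq_addr.
by rewrite subr_ge0 ler_nat ltnW // (leq_trans (ltn_ord i)).
Qed.

(** 1 - \prod (1 - x_i) <= \sum x_i with x_i = (2i + 1) / (N + i + 1). *)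
Lemma weight_defect_le N k : (0 < N)%N -> 1 - weight N k <= k%:R ^+ 2 / N%:R.
Proof.
move=> N0; have n0 : 0 < N%:R :> R by rewrite ltr0n.
elim: k => [|k IH]; first by rewrite weight0 subrr expr0n mul0r.
have d0 : 0 < (N + k.+1)%:R :> R by rewrite ltr0n addnS.
have -> : 1 - weight N k.+1 = (1 - weight N k) + weight N k * ((k.*2.+1)%:R / (N + k.+1)%:R).
  have := weightS R N k => /(canRL (mulKf (lt0r_neq0 d0))) ->.
  have e : (N + k.+1)%:R = N%:R + (k%:R + 1) :> R by rewrite natrD -natr1.
  rewrite -muln2 -[_.+1%:R]natr1 natrM !e; rewrite e in d0; field.
  by rewrite lt0r_neq0.
have -> : k.+1%:R ^+ 2 / N%:R = k%:R ^+ 2 / N%:R + (k.*2.+1)%:R / N%:R :> R.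
  have e2 : (k.*2.+1)%:R = 2 * k%:R + 1 :> R by rewrite -natr1 -mul2n natrM.
  by rewrite -mulrDl e2 -natr1; congr (_ / _); ring.
apply: lerD => //; rewrite -[leRHS]mul1r ler_pM ?weight_nonneg ?weight_le1 ?divr_ge0 //.
by rewrite ler_wpM2l // lef_pV2 ?posrE // ler_nat leq_addr.
Qed.

(** 1/(x+1)^2 <= 1/(x(x+1)). *)
Lemma inv_sqr_le_telescope (x : R) : 0 < x -> ((x + 1) ^+ 2)^-1 <= x^-1 - (x + 1)^-1.
Proof.
move=> x0; have x1 : 0 < x + 1 by rewrite addr_gt0.
have -> : x^-1 - (x + 1)^-1 = (x * (x + 1))^-1.
  by field; rewrite !lt0r_neq0.
rewrite lef_pV2 ?posrE ?exprn_gt0 ?mulr_gt0 // expr2 ler_pM2r //.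
by rewrite lerDl.
Qed.

Lemma sum_inv_sqr_tail M N : (0 < M)%N ->
  \sum_(M.+1 <= k < N.+1) (k%:R ^+ 2)^-1 <= M%:R^-1 :> R.
Proof.
move=> M0; have [NM|MN] := leqP N M; first by rewrite big_geq ?invr_ge0.
rewrite -(subnK (ltnW MN)); move: (N - M)%N => m {MN}.
suff : \sum_(M.+1 <= k < (m + M).+1) (k%:R ^+ 2)^-1 <= M%:R^-1 - (m + M)%:R^-1 :> R.
  by move=> /le_trans; apply; rewrite gerBl invr_ge0.
elim: m => [|m IH]; first by rewrite big_geq // subrr.
rewrite addSn big_nat_recr ?ltnS ?leq_addl //=.
apply: le_trans (lerD IH (lexx _)) _.
have m0 : 0 < (m + M)%:R :> R by rewrite ltr0n addn_gt0 M0 orbT.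
have h := inv_sqr_le_telescope m0; rewrite natr1 in h.
by apply: le_trans (lerD (lexx _) h) _; rewrite addrA subrK.
Qed.

Lemma sum_inv_sqr_le2 N : \sum_(1 <= k < N.+1) (k%:R ^+ 2)^-1 <= 2 :> R.
Proof.
case: N => [|N]; first by rewrite big_geq.
rewrite big_ltn // expr1n invr1.
by have := @sum_inv_sqr_tail 1 N.+1 isT; rewrite invr1; lra.
Qed.

(** Below M the weights are within k^2/N of 1, which cancels the decay of f; above M
    the tail of f itself is small. *)
Lemma weighted_sum_diff (f : nat -> R) (C : R) M N : (0 < M)%N -> (M <= N)%N ->
  (forall k, (0 < k)%N -> `|f k| <= C / k%:R ^+ 2) ->
  `|\sum_(1 <= k < N.+1) weight N k * f k - \sum_(1 <= k < N.+1) f k|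
   <= C * M%:R / N%:R + C / M%:R.
Proof.
move=> M0 MN hf; rewrite -sumrB.
have C0 : 0 <= C by have := hf 1%N isT; rewrite expr1n divr1; apply: le_trans.
rewrite (big_cat_nat _ (n := M.+1)) //=; apply: le_trans (ler_normD _ _) _.
have n0 : N%:R != 0 :> R by rewrite pnatr_eq0 -lt0n (leq_trans M0).
have ft k : weight N k * f k - f k = - ((1 - weight N k) * f k) by ring.
have w0 k : 0 <= 1 - weight N k by rewrite subr_ge0 weight_le1.
apply: lerD.
  apply: le_trans (ler_norm_sum _ _ _) _.
  apply: (@le_trans _ _ (\sum_(1 <= k < M.+1) C / N%:R)).
    apply: ler_sum_nat => k /andP[k0 _].
    rewrite ft normrN normrM (ger0_norm (w0 _)).
    have k2 : k%:R ^+ 2 != 0 :> R by rewrite expf_neq0 // pnatr_eq0 -lt0n.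
    have -> : C / N%:R = (k%:R ^+ 2 / N%:R) * (C / k%:R ^+ 2).
      by move: (k%:R ^+ 2) k2 => x x0; field; rewrite x0.
    by apply: ler_pM (hf _ k0) => //; apply: weight_defect_le; exact: leq_trans MN.
  by rewrite sumr_const_nat subn1 /= -mulrnAl mulr_natr.
apply: le_trans (ler_norm_sum _ _ _) _.
apply: (@le_trans _ _ (C * \sum_(M.+1 <= k < N.+1) (k%:R ^+ 2)^-1)).
  rewrite mulr_sumr; apply: ler_sum_nat => k /andP[k0 _].
  rewrite ft normrN normrM (ger0_norm (w0 _)) -[leRHS]mul1r.
  by apply: ler_pM (hf _ _) => //; [rewrite gerBl weight_nonneg|exact: leq_trans k0].
by rewrite ler_wpM2l // sum_inv_sqr_tail.
Qed.

Lemma weighted_sum_cvg (f : nat -> R) (C : R) :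
  (forall k, (0 < k)%N -> `|f k| <= C / k%:R ^+ 2) ->
  (fun N => \sum_(1 <= k < N.+1) weight N k * f k - \sum_(1 <= k < N.+1) f k) @ \oo
    --> (0 : R).
Proof.
move=> hf; have C0 : 0 <= C by have := hf 1%N isT; rewrite expr1n divr1; apply: le_trans.
apply/cvgrPdist_lt => e e0.
(* chosen so that the tail bound C / M is below e / 2 *)
pose M := (Num.truncn (2 * C / e)).+1.
have M1 : C / M%:R < e / 2.
  have : 2 * C / e < M%:R by rewrite truncnS_gt.
  have m0 : 0 < M%:R :> R by rewrite ltr0n.
  by rewrite !ltr_pdivrMr //; lra.
near=> N.
have MN : (M <= N)%N by near: N; exact: nbhs_infty_ge.
have n0 : 0 < N%:R :> R by rewrite ltr0n (leq_trans _ MN).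
rewrite sub0r normrN; apply: le_lt_trans (weighted_sum_diff _ MN hf) _ => //.
suff : C * M%:R / N%:R < e / 2 by lra.
have : 2 * C * M%:R / e < N%:R by near: N; exact: nbhs_infty_gtr.
by rewrite !ltr_pdivrMr //; lra.
Unshelve. all: by end_near.
Qed.

End Tannery.

(** * Limits of the ladder sums and of the star sums *)

Section LadderLimit.
Local Open Scope classical_set_scope.
Variable R : realType.

Lemma alt_inv_pow_le m k : (0 < m)%N -> (0 < k)%N ->
  `|alt_inv_pow R m k| <= (k%:R ^+ 2)^-1.
Proof.
move=> m0 k0; have k1 : 0 < k%:R :> R by rewrite ltr0n.
rewrite /alt_inv_pow /alt_sign normrM normrX normrN1 expr1n mul1r.
rewrite ger0_norm ?invr_ge0 ?exprn_ge0 // lef_pV2 ?posrE ?exprn_gt0 //.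
by rewrite ler_weXn2l ?ler1n // -[2%N]muln1 leq_mul2l.
Qed.

Lemma ladder_sum_bounded m n : (0 < m)%N ->
  exists2 D, 0 <= D & forall N, `|ladder_sum R m n N| <= D.
Proof.
move=> m0; elim: n => [|n [D D0 hD]]; first by exists 1 => // N; rewrite normr1.
exists (2 * D * 2) => [|N]; first by rewrite !mulr_ge0.
apply: le_trans (ler_norm_sum _ _ _) _.
apply: (@le_trans _ _ (2 * D * \sum_(1 <= k < N.+1) (k%:R ^+ 2)^-1)).
  rewrite mulr_sumr; apply: ler_sum_nat => k /andP[k0 _].
  rewrite ladder_iterE // normrM mulrC ler_pM ?alt_inv_pow_le //.
  by apply: le_trans (ler_normD _ _) _; rewrite mulr_natl mulr2n lerD.
by rewrite ler_wpM2l ?mulr_ge0 // sum_inv_sqr_le2.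
Qed.

Lemma ladder_iter_bounded m n : (0 < m)%N ->
  exists C, forall k, (0 < k)%N -> `|ladder_iter R m n.+1 k| <= C / k%:R ^+ 2.
Proof.
move=> m0; have [D D0 hD] := ladder_sum_bounded n m0.
exists (2 * D) => k k0; rewrite ladder_iterE // normrM mulrC.
rewrite ler_pM ?alt_inv_pow_le //.
by apply: le_trans (ler_normD _ _) _; rewrite mulr_natl mulr2n lerD.
Qed.

Lemma cvg_pow (u : nat -> R) (l : R) n :
  u @ \oo --> l -> (fun N => u N ^+ n) @ \oo --> l ^+ n.
Proof.
move=> ul; elim: n => [|n IH]; first exact: cvg_cst.
rewrite (_ : (fun N => u N ^+ n.+1) = u \* (fun N => u N ^+ n)); last first.
  by apply/funext => N; rewrite /= exprS.
by rewrite exprS; apply: cvgM.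
Qed.

Lemma cvg_eq_positive (u v : nat -> R) (l : R) :
  (forall N, (0 < N)%N -> u N = v N) -> u @ \oo --> l -> v @ \oo --> l.
Proof.
move=> uv; rewrite -(cvg_shiftS u) -(cvg_shiftS v).
by under eq_fun do rewrite uv //.
Qed.

(** Both directions are of use: from the star sums to a plain sum for {2}^p, and
    back for the repeated blocks. *)
Lemma represents_cvg s (f : nat -> R) (C l : R) : represents f s ->
  (forall k, (0 < k)%N -> `|f k| <= C / k%:R ^+ 2) ->
  (star_sum R s @ \oo --> l) <-> ((fun N => \sum_(1 <= k < N.+1) f k) @ \oo --> l).
Proof.
move=> rf hf; have cw := weighted_sum_cvg hf.
have e N : (0 < N)%N -> star_sum R s N = (\sum_(1 <= k < N.+1) weight R N k * f k -
    \sum_(1 <= k < N.+1) f k) + \sum_(1 <= k < N.+1) f k.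
  by move=> N0; rewrite subrK rf.
split=> h.
  apply: (@cvg_eq_positive (fun N => star_sum R s N - (\sum_(1 <= k < N.+1) weight R N k * f k -
    \sum_(1 <= k < N.+1) f k))); first by move=> N N0; rewrite e //; ring.
  by rewrite -[l]subr0; apply: cvgB.
apply: (@cvg_eq_positive (fun N => (\sum_(1 <= k < N.+1) weight R N k * f k -
    \sum_(1 <= k < N.+1) f k) + \sum_(1 <= k < N.+1) f k)); first by move=> N N0; rewrite e.
by rewrite -[l]add0r; apply: cvgD.
Qed.

Variable B : nat -> R.
Hypothesis hB : bernoulli_numbers B.

Lemma alt_inv_pow_sum_cvg p : (0 < p)%N ->
  (fun N => 2 * \sum_(1 <= k < N.+1) alt_inv_pow R p k) @ \oo -->
  (-1) ^+ p * pi ^+ (2 * p) * csch_coef B (2 * p).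
Proof.
move=> p0; under eq_fun do rewrite mulr_sumr.
apply: (represents_cvg (C := 2) _ (represents_twos R p) _).1; last exact: star_sum_twos_cvg.
by move=> k k0; rewrite normrM ger0_norm // ler_wpM2l // alt_inv_pow_le.
Qed.

Lemma alt_inv_powX m j k : alt_inv_pow R m k ^+ j.*2.+1 = alt_inv_pow R (m * j.*2.+1) k.
Proof.
rewrite /alt_inv_pow /alt_sign expr_div_n -!exprM mulnA.
congr (_ / _).
by rewrite -[LHS]signr_odd oddM /= odd_double andbT signr_odd.
Qed.

(** The constraint on k makes the factors (-1)^m and pi^(2m), raised to the power
    (2j + 1) k_j, multiply up to the power n. *)
Lemma bernoulli_sum_scale m d n :
  \sum_(k : {ffun 'I_d -> 'I_n.+1} | (\sum_(j < d) j.*2.+1 * k j == n)%N)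
    \prod_(j < d) (((k j)`!)%:R^-1 *
      (((-1) ^+ (m * j.*2.+1) * pi ^+ (2 * (m * j.*2.+1)) * csch_coef B (2 * (m * j.*2.+1)))
         / j.*2.+1%:R) ^+ k j) =
  (-1) ^+ (m * n) * pi ^+ (2 * m * n) * bernoulli_sum B m d n.
Proof.
rewrite /bernoulli_sum mulr_sumr; apply: eq_bigr => k /eqP hk.
rewrite -[in (-1) ^+ (m * n)]hk -[in pi ^+ _]hk !big_distrr /= -!prodrXr -!big_split /=.
apply: eq_bigr => j _.
rewrite [RHS]mulrCA; congr (_ * _).
rewrite !exprM -!exprMn; congr (_ ^+ _).
rewrite /bernoulli_coef /csch_coef !mulnA invfM; ring.
Qed.

(** The expansion at level N is a polynomial in finitely many power sums of the a_k,
    and a_k^p for odd p is again of the form (-1)^(k-1) / k^(2mp). *)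
Lemma ladder_sum_cvg m d n : (0 < m)%N -> (n <= 2 * d)%N ->
  ladder_sum R m n @ \oo -->
  (-1) ^+ (m * n) * pi ^+ (2 * m * n) * bernoulli_sum B m d n.
Proof.
move=> m0 nd; rewrite -bernoulli_sum_scale.
pose s j N := (2 * \sum_(1 <= i < N.+1) alt_inv_pow R m i ^+ j.*2.+1) / j.*2.+1%:R.
rewrite (_ : ladder_sum R m n = fun N =>
    \sum_(k : {ffun 'I_d -> 'I_n.+1} | (\sum_(j < d) j.*2.+1 * k j == n)%N)
      \prod_(j < d) (((k j)`!)%:R^-1 * s j N ^+ k j)); last first.
  apply/funext => N; apply: odd_power_sum_expansion => //.
  - by move=> n'; rewrite /ladder_sum big_geq.
  - exact: ladder_sumS.
apply: cvg_finite_sum => k; apply: cvg_finite_prod => j; apply: cvgMl_tmp.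
apply: cvg_pow; apply: cvgMr_tmp.
under eq_fun do under eq_bigr do rewrite alt_inv_powX.
by apply: alt_inv_pow_sum_cvg; rewrite muln_gt0 m0.
Qed.

Lemma star_sum_cvg s m d n : (0 < m)%N -> (0 < n <= 2 * d)%N ->
  represents (ladder_iter R m n) s ->
  star_sum R s @ \oo -->
  (-1) ^+ (m * n) * pi ^+ (2 * m * n) * bernoulli_sum B m d n.
Proof.
case: n => // n m0 nd rs; have [C hC] := ladder_iter_bounded n m0.
by apply/(represents_cvg _ rs hC); exact: ladder_sum_cvg.
Qed.

End LadderLimit.

(** * Multiple zeta star values as limits of finite star sums *)

Section ZetaStar.
Local Open Scope classical_set_scope.
Variable R : realType.

(** The index set of a finite star sum, enumerated in the order of its recursion. *)
Fixpoint descents (l N : nat) : seq (seq nat) :=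
  if l is l'.+1 then [seq j :: t | j <- iota 1 N, t <- descents l' j] else [:: [::]].

Lemma mem_descents l N k : (k \in descents l N) =
  [&& size k == l, path geq N k & all (fun i => 0 < i)%N k].
Proof.
elim: l N k => [|l IH] N k; first by rewrite inE; case: k.
apply/allpairsPdep/idP => [[j [t [jN]]]|].
  rewrite IH => /and3P[/eqP <- pt at_] ->; rewrite mem_iota in jN.
  by case/andP: jN => j0; rewrite add1n ltnS => jN; rewrite /= eqxx jN j0 pt.
case: k => // j t /= /and3P[]; rewrite eqSS => st /andP[jN pt] /andP[j0 at_].
by exists j, t; rewrite mem_iota add1n ltnS j0 jN IH st pt.
Qed.

Lemma uniq_descents l N : uniq (descents l N).
Proof.
elim: l N => // l IH N; apply: allpairs_uniq_dep => //; first exact: iota_uniq.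
by move=> [j t] [j' t'] _ _ /= [-> ->].
Qed.

Definition star_term (s k : seq nat) : R :=
  \prod_(i < size s) ((nth 0%N k i)%:R ^+ nth 0%N s i)^-1.

Lemma star_sum_descents s N :
  star_sum R s N = \sum_(k <- descents (size s) N) star_term s k.
Proof.
elim: s N => [|a s IH] N; first by rewrite /= big_seq1 /star_term big_ord0.
rewrite /= big_allpairs_dep /= -[1%N in LHS]add0n /index_iota subn1 /=.
apply: eq_bigr => j _; rewrite IH mulr_sumr; apply: eq_bigr => t _.
by rewrite /star_term big_ord_recl.
Qed.

Lemma star_term_ge0 s k : 0 <= star_term s k.
Proof. by apply: prodr_ge0 => i _; rewrite invr_ge0 exprn_ge0. Qed.

Lemma star_sum_ge0 s N : 0 <= star_sum R s N.
Proof. by rewrite star_sum_descents sumr_ge0 // => k _; exact: star_term_ge0. Qed.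

Lemma star_sum_nondecreasing s : nondecreasing_seq (star_sum R s).
Proof.
apply/nondecreasing_seqP => N; case: s => [|a s] //=.
by rewrite [leRHS]big_nat_recr //= lerDl mulr_ge0 ?star_sum_ge0 // invr_ge0 exprn_ge0.
Qed.

Definition star_index (s : seq nat) : set (seq nat) :=
  [set k | [&& size k == size s, sorted geq k & all (fun i => 0 < i)%N k]].

Lemma zeta_star_esum s :
  zeta_star R s = \esum_(k in star_index s) (star_term s k)%:E.
Proof.
rewrite (@reindex_esum _ _ _ [set k : (size s).-tuple nat |
  sorted geq k && all (fun i => 0 < i)%N k] _ (fun k => tval k)).
  apply: eq_esum => k _; congr EFin; apply: eq_bigr => i _.
  by rewrite (tnth_nth 0%N).
split.
- by move=> k /= h; rewrite /star_index /= size_tuple eqxx.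
- by move=> k k' _ _ /val_inj.
- by move=> k /and3P[sk hk pk]; exists (Tuple sk); rewrite //= hk pk.
Qed.

Lemma descents_sub_star_index s N : [set` descents (size s) N] `<=` star_index s.
Proof.
move=> k /=; rewrite mem_descents /star_index /= => /and3P[-> pk ->].
by rewrite (path_sorted pk).
Qed.

Lemma fsum_descents s N :
  (\sum_(k \in [set` descents (size s) N]) (star_term s k)%:E)%E = (star_sum R s N)%:E.
Proof. by rewrite -fsbig_seq ?uniq_descents // sumEFin star_sum_descents. Qed.

(** A finite set of indices is contained in some set of bounded decreasing sequences,
    so the unordered sum is the supremum of the finite star sums. *)
Lemma zeta_star_cvg s (l : R) : star_sum R s @ \oo --> l -> zeta_star R s = l%:E.
Proof.
move=> sl; rewrite zeta_star_esum; apply/eqP; rewrite eq_le; apply/andP; split.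
  apply: ge_ereal_sup => _ [X [finX XS] <-].
  have [r Xr] := (finite_seqP X).1 finX.
  pose N := (\max_(k <- r) head 0 k)%N.
  have XD : X `<=` [set` descents (size s) N].
    move=> k Xk; have /and3P[sk hk pk] := XS _ Xk.
    rewrite /= mem_descents sk pk andbT /=.
    have : (head 0 k <= N)%N.
      by apply: leq_bigmax_seq => //; move: Xk; rewrite Xr.
    by case: k hk {Xk sk pk} => //= a k -> ->.
  apply: (@le_trans _ _ (star_sum R s N)%:E); last first.
    rewrite lee_fin -(cvg_lim (@Rhausdorff R) sl); apply: nondecreasing_cvgn_le.
      exact: star_sum_nondecreasing.
    by apply/cvg_ex; exists l.
  rewrite -fsum_descents; apply: lee_fsum_nneg_subset => //.
  - exact: finite_seq.
  - by move=> k; rewrite !inE; exact: XD.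
  - by move=> k _; rewrite lee_fin star_term_ge0.
have le_star N : ((star_sum R s N)%:E <= \esum_(k in star_index s) (star_term s k)%:E)%E.
  apply: esum_ge; exists [set` descents (size s) N]; last by rewrite fsum_descents.
  by split; [exact: finite_seq|exact: descents_sub_star_index].
case: esum le_star => [v|_|/(_ 0%N)] //; last by rewrite leey.
by move=> le_star; rewrite lee_fin; apply: (cvgr_to_le sl); apply: nearW => N; rewrite -lee_fin.
Qed.

End ZetaStar.

Theorem theorem1p4 (R : realType) (B : nat -> R) (hB : bernoulli_numbers B)
    (d m : nat) (hd : (0 < d)%N) (hm : (0 < m)%N) :
  zeta_star R (repeat_seq d (block m)) =
    (pi ^+ (4 * m * d) * bernoulli_sum B m d (2 * d))%:E
  /\
  zeta_star R (repeat_seq d (block m) ++ nseq m 2%N) =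
    ((-1) ^+ m * (pi ^+ (2 * m * (2 * d + 1))
       * bernoulli_sum B m d.+1 (2 * d + 1)))%:E.
Proof.
have sgn : (-1) ^+ (m * (2 * d)) = 1 :> R by rewrite mulnCA exprM sqrrN !expr1n.
split; apply: zeta_star_cvg.
  have -> : pi ^+ (4 * m * d) = (-1) ^+ (m * (2 * d)) * pi ^+ (2 * m * (2 * d)) :> R.
    by rewrite sgn mul1r; congr (_ ^+ _); rewrite mulnACA mulnA.
  by apply: star_sum_cvg (represents_repeat R d hm) => //; rewrite muln_gt0 hd leqnn.
have -> : (-1) ^+ m = (-1) ^+ (m * (2 * d + 1)) :> R.
  by rewrite mulnDr muln1 exprD sgn mul1r.
rewrite mulrA addn1.
apply: star_sum_cvg (represents_repeat_twos R d hm) => //.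
by rewrite /= mulnS.
Qed.
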